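(* Let $T>0$, $\mu>0$, $\mathcal R\in\mathbb R^{m\times n}$, let $a_r\in H^2(0,T;\mathbb R^n)$, suppose $\operatorname{rank}C_\varepsilon=n$, let $C_\varepsilon^\dagger$ be a fixed right inverse of $C_\varepsilon$, and let $\eta_r=C_\varepsilon^\dagger(\ddot a_r+\Lambda a_r)$. Let $I_1,\dots,I_{N_c}\subset(0,\infty)$ be compact and suppose $(\eta_r)_\alpha\in\mathcal B_T(I_\alpha)$ for all $\alpha$. Let the initial state be $x_0=0$, let $a_d=\mathcal R a_r$, and suppose the compatibility conditions for exact tracking hold: $a_r(0)=\dot a_r(0)=0$ and $\eta_r(0)=\dot\eta_r(0)=0$. Then $$V_\mu(a_d;0)\le\frac{\mu}{2}\sum_{\alpha=1}^{N_c}\Big(\sup_{\nu\in I_\alpha}d_{\alpha,\varepsilon}(\nu)\Big)^2\|(\eta_r)_\alpha\|_{\mathcal B_T(I_\alpha)}^2 .$$ Consequently, $$V_\mu(a_d;0)\le\frac{\mu}{2}\,\Delta_\varepsilon(I_1,\dots,I_{N_c})^2\,\|\eta_r\|_{\prod_\alpha\mathcal B_T(I_\alpha)}^2 .$$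
   Context: $\Lambda=\operatorname{diag}(\omega_1^2,\dots,\omega_n^2)$ with $\omega_k>0$; $C_\varepsilon\in\mathbb R^{n\times N_c}$ is a real matrix. For $\alpha=1,\dots,N_c$, $\gamma_\alpha^\varepsilon>0$ and $\omega_\alpha^\varepsilon>0$ are given numbers, and $\Gamma_\varepsilon=\operatorname{diag}(\gamma_\alpha^\varepsilon)$, $K_\varepsilon=\operatorname{diag}((\omega_\alpha^\varepsilon)^2+(\gamma_\alpha^\varepsilon)^2)$. The control system is $$\ddot a+\Lambda a=C_\varepsilon\eta,\qquad \ddot\eta+2\Gamma_\varepsilon\dot\eta+K_\varepsilon\eta=u\quad\text{on }(0,T),$$ with initial state $x_0=(a(0),\dot a(0),\eta(0),\dot\eta(0))$ and control $u\in L^2(0,T;\mathbb R^{N_c})$; $a(t;u)$ is its $a$-component. The optimal value is $$V_\mu(a_d;x_0)=\inf_{u\in L^2(0,T;\mathbb R^{N_c})}\Big\{\frac12\int_0^T\|\mathcal R a(t;u)-a_d(t)\|^2dt+\frac\mu2\int_0^T\|u(t)\|^2dt\Big\}.$$ Define $$d_{\alpha,\varepsilon}(\nu)=\big|(\omega_\alpha^\varepsilon)^2+(\gamma_\alpha^\varepsilon)^2-\nu^2+2\mathrm i\gamma_\alpha^\varepsilon\nu\big|,\qquad \Delta_\varepsilon(I_1,\dots,I_{N_c})=\max_{1\le\alpha\le N_c}\sup_{\nu\in I_\alpha}d_{\alpha,\varepsilon}(\nu).$$ Finite-time band class: for compact $I\subset(0,\infty)$, $g\in L^2(0,T)$ belongs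 to $\mathcal B_T(I)$ if there is $\widetilde g\in L^2(\mathbb R)$ with $\widetilde g|_{(0,T)}=g$ and $\operatorname{supp}\widehat{\widetilde g}\subset I\cup(-I)$; the norm is $\|g\|_{\mathcal B_T(I)}=\inf\|\widetilde g\|_{L^2(\mathbb R)}$ over all such $\widetilde g$. The Fourier transform uses angular frequency, $\widehat{\partial_t g}(\nu)=\mathrm i\nu\widehat g(\nu)$. Elements of $\mathcal B_T(I)$ are identified with their smooth representatives on $[0,T]$. The product norm is $\|\eta\|_{\prod_\alpha\mathcal B_T(I_\alpha)}^2=\sum_{\alpha=1}^{N_c}\|\eta_\alpha\|_{\mathcal B_T(I_\alpha)}^2$. *)

(* Defs.v *)
From HB Require Import structures.
From mathcomp Require Import all_boot all_order all_algebra.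
From mathcomp Require Import all_classical all_reals all_analysis.
From mathcomp Require Import complex.

Set Implicit Arguments.
Unset Strict Implicit.
Unset Printing Implicit Defensive.

Import Order.TTheory GRing.Theory Num.Theory.
Import numFieldNormedType.Exports.

Local Open Scope classical_set_scope.
Local Open Scope ring_scope.

(* All statements below are about functions of a real variable; a function on
   [0, T] is a function on R of which only the values on [0, T] matter. *)

Section L2.
Context {R : realType}.
Local Notation leb := (@lebesgue_measure R).

Definition L2 (D : set R) (f : R -> R) : Prop := (f \_ D) \in Lfun leb 2%:E.

Definition L2norm (f : R -> R) : R := fine ('N[leb]_2%:E[EFin \o f])%E.

Definition L2vec (p : nat) (D : set R) (f : R -> 'cV[R]_p) : Prop :=
  forall i, L2 D (fun t => f t i 0).

(* The library norm on matrices is the sup norm, hence this definition. *)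
Definition sqnorm (p : nat) (v : 'cV[R]_p) : R := \sum_i v i 0 ^+ 2.

Definition sqint (p : nat) (T : R) (f : R -> 'cV[R]_p) : \bar R :=
  (\int[leb]_(t in `]0%R, T[) (sqnorm (f t))%:E)%E.

End L2.

Section Sobolev.
Context {R : realType}.
Local Notation leb := (@lebesgue_measure R).

Definition primitive (T : R) (f g : R -> R) : Prop :=
  forall t : R, t \in `[0, T] -> f t = f 0 + \int[leb]_(s in `[0, t]) g s.

(* x is (the C^1 representative of) an element of H^2(0,T;R^p), x1 is its
   derivative on [0, T], and x2 is a representative of its second derivative. *)
Definition H2 (p : nat) (T : R) (x x1 x2 : R -> 'cV[R]_p) : Prop :=
  L2vec `]0, T[ x2 /\
  forall i, primitive T (fun t => x t i 0) (fun t => x1 t i 0) /\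
            primitive T (fun t => x1 t i 0) (fun t => x2 t i 0).

End Sobolev.

Section ControlSystem.
Context {R : realType}.
Local Notation leb := (@lebesgue_measure R).
Variables (n Nc : nat).
Variables (omega : 'I_n -> R) (gammac omegac : 'I_Nc -> R).
Variable C : 'M[R]_(n, Nc).

Definition LambdaM : 'M[R]_n := diag_mx (\row_k omega k ^+ 2).
Definition GammaM : 'M[R]_Nc := diag_mx (\row_al gammac al).
Definition KM : 'M[R]_Nc := diag_mx (\row_al (omegac al ^+ 2 + gammac al ^+ 2)).

(* (a, a', eta, eta') *)
Definition state : Type := 'cV[R]_n * 'cV[R]_n * 'cV[R]_Nc * 'cV[R]_Nc.

(* a is the a-component a(.;u) of the Caratheodory solution on [0, T]. *)
Definition a_component (T : R) (x0 : state) (u : R -> 'cV[R]_Nc)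
    (a : R -> 'cV[R]_n) : Prop :=
  exists (a1 a2 : R -> 'cV[R]_n) (eta eta1 eta2 : R -> 'cV[R]_Nc),
    [/\ H2 T a a1 a2, H2 T eta eta1 eta2,
        (a 0, a1 0, eta 0, eta1 0) = x0,
        {ae leb, forall t, t \in `]0, T[ ->
           a2 t + LambdaM *m a t = C *m eta t} &
        {ae leb, forall t, t \in `]0, T[ ->
           eta2 t + 2 *: (GammaM *m eta1 t) + KM *m eta t = u t}].

Definition optimal_value (m : nat) (T mu : R) (Robs : 'M[R]_(m, n))
    (a_d : R -> 'cV[R]_m) (x0 : state) : \bar R :=
  ereal_inf [set J : \bar R | exists u a,
    [/\ L2vec `]0, T[ u, a_component T x0 u a &
        J = ((2^-1)%R%:E * sqint T (fun t => Robs *m a t - a_d t)%R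
             + (mu / 2)%R%:E * sqint T u)%E]].

Definition dsymb (al : 'I_Nc) (nu : R) : R :=
  Normc.normc ((omegac al ^+ 2 + gammac al ^+ 2 - nu ^+ 2)
               +i* (2 * gammac al * nu))%C.

(* sup set0 = 0, which is the supremum in [0, +oo[ *)
Definition supd (I : 'I_Nc -> set R) (al : 'I_Nc) : R :=
  sup [set dsymb al nu | nu in I al].

Definition Delta (I : 'I_Nc -> set R) : R :=
  \big[Num.max/0]_(al < Nc) supd I al.

End ControlSystem.

Section Fourier.
Context {R : realType}.
Local Notation leb := (@lebesgue_measure R).

(* \int_(-A)^A g(t) e^(-i nu t) dt *)
Definition fourier_trunc (g : R -> R) (A nu : R) : R[i] :=
  ((\int[leb]_(t in `[- A, A]) (g t * cos (nu * t)))
   +i* (- \int[leb]_(t in `[- A, A]) (g t * sin (nu * t))))%C.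

(* G is the Fourier-Plancherel transform of g \in L^2(R): the limit in L^2 of
   the Fourier integrals of the truncations of g. *)
Definition is_fourier (g : R -> R) (G : R -> R[i]) : Prop :=
  [/\ L2 setT (fun nu => complex.Re (G nu)),
      L2 setT (fun nu => complex.Im (G nu)) &
      (fun N : nat => (\int[leb]_nu
         (Normc.normc (fourier_trunc g N%:R nu - G nu) ^+ 2)%:E)%E)
        @ \oo --> 0%E].

(* support of an a.e.-class: the complement of the largest open set on which
   G vanishes almost everywhere *)
Definition ess_support (G : R -> R[i]) : set R :=
  [set nu | forall U, nbhs nu U -> ~ {ae leb, forall x, U x -> G x = 0}].

Definition band_extension (T : R) (I : set R) (g gt : R -> R) : Prop :=
  [/\ L2 setT gt,
      {ae leb, forall t, t \in `]0, T[ -> gt t = g t} &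
      exists G, is_fourier gt G /\
        ess_support G `<=` I `|` [set - nu | nu in I]].

Definition band_class (T : R) (I : set R) (g : R -> R) : Prop :=
  L2 `]0, T[ g /\ exists gt, band_extension T I g gt.

Definition band_norm (T : R) (I : set R) (g : R -> R) : R :=
  inf [set L2norm gt | gt in band_extension T I g].

Definition prod_band_norm (Nc : nat) (T : R) (I : 'I_Nc -> set R)
    (f : R -> 'cV[R]_Nc) : R :=
  Num.sqrt (\sum_al band_norm T (I al) (fun t => f t al 0) ^+ 2).

(* h is a smooth representative of g on [0, T], given together with a smooth
   extension to R; the values of h and h' on [0, T] do not depend on the choice
   of this extension. *)
Definition smooth_rep (T : R) (g h : R -> R) : Prop :=
  (forall (k : nat) (x : R), derivable (derive1n k h) x 1) /\
  {ae leb, forall t, t \in `]0, T[ -> g t = h t}.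

End Fourier.

(* Main.v *)
(* With a := a_r and eta the smooth representative h of eta_r, the tracking
   term vanishes and the control is u = h'' + 2 gamma h' + (omega^2 + gamma^2) h,
   so all that is needed is |u|_(L^2(0,T)) <= D |gt|_(L^2(R)), where D is the
   supremum of d over the band I, for every band-limited extension gt of eta_r.

   This is proved by duality, without inverting the Fourier transform. Let
   p = v^2 u for a cutoff v vanishing at 0 and T, and let q be the formal adjoint
   p'' - 2 gamma p' + (omega^2 + gamma^2) p, so that |q^| = d |p^|. Integration by
   parts gives <u, p> = <h, q> = <gt, q>, and Parseval turns this into a frequency
   integral, which only sees the band, where |q^| <= D |p^|. Hence
   <u, p> <= D |gt| |p|, and v -> 1 concludes.

   Parseval and Bessel are only used for truncations of gt to [-N, N], with the
   frequency integral restricted to [0, +oo) and weighted by exp (- v / A). The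
   weight turns the product of two transforms into a convolution with the Poisson
   kernel A / (1 + (A x)^2), an approximate identity as A -> +oo up to the factor
   pi, and this factor cancels between the two inequalities. *)
Require Import Defs.
From HB Require Import structures.
From mathcomp Require Import all_boot all_order all_algebra.
From mathcomp Require Import all_classical all_reals all_analysis.
From mathcomp Require Import complex.
From mathcomp Require Import measurable_realfun ring lra.

Set Implicit Arguments.
Unset Strict Implicit.
Unset Printing Implicit Defensive.

Import Order.TTheory GRing.Theory Num.Theory.
Import numFieldNormedType.Exports.

Local Open Scope classical_set_scope.
Local Open Scope ring_scope.

(** * Change of variables and derivatives *)

Section AffineChange.
Context {R : realType}.
Local Notation leb := (@lebesgue_measure R).

Variables (a b : R) (a0 : 0 < a).

Let phi : measurableTypeR R -> measurableTypeR R := fun x => a * x + b.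

Let mphi : measurable_fun setT phi.
Proof. by apply: measurable_funD => //; exact: measurable_funM. Qed.

Let image : {measure set (measurableTypeR R) -> \bar R} :=
  mscale (NngNum (ltW a0))
    (measure_function_pushforward__canonical__measure_function_Measure leb mphi).

(** The scaled pushforward [image] gives []p, q]] the mass a * ((q - p) / a), which is its length,
    and Lebesgue measure is determined by these values. *)
Lemma lebesgue_measure_affine (A : set (measurableTypeR R)) :
  measurable A -> leb A = image A.
Proof.
move=> mA; rewrite (@lebesgue_measure_unique R image) //= => _ [[p q]] _ <-.
rewrite /image /= /mscale /= /pushforward /=.
have -> : phi @^-1` `]p, q] = `]((p - b) / a), ((q - b) / a)]%classic.
  apply/seteqP; split => x /=; rewrite !in_itv/= ltr_pdivrMr// ler_pdivlMr//;
    by rewrite ltrBlDr lerBrDr /phi mulrC.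
rewrite !lebesgue_measure_itv /= !lte_fin ltr_pM2r ?invr_gt0// ltrD2r.
case: ifP => _; last by rewrite mule0.
by rewrite -!EFinB -EFinM; congr (_%:E); field; exact: lt0r_neq0.
Qed.

Lemma ge0_integral_affine (f : R -> \bar R) :
  measurable_fun setT f -> (forall x, 0 <= f x)%E ->
  (\int[leb]_x f x = a%:E * \int[leb]_x f (a * x + b)%R)%E.
Proof.
move=> mf f0; rewrite (@eq_measure_integral _ _ _ _ image); last first.
  by move=> A mA _; exact: lebesgue_measure_affine.
by rewrite ge0_integral_mscale//= ge0_integral_pushforward.
Qed.

End AffineChange.

Section Deriv.
Context {R : realType}.
Implicit Types f g : R -> R.

(** Carrying the derivative as an explicit function lets the rules below assemble it, and
    [has_deriv_eq] simplify it, without computing [derive1]. *)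
Definition has_deriv f f' := forall x : R, is_derive x (1 : R) f (f' x).

Lemma has_deriv_continuous f f' : has_deriv f f' -> continuous f.
Proof.
move=> ff' x; apply: differentiable_continuous; apply/derivable1_diffP.
by have [] := ff' x.
Qed.

Lemma has_deriv_cst (k : R) : has_deriv (fun=> k) (fun=> 0).
Proof. by move=> x; exact: is_derive_cst. Qed.

Lemma has_deriv_id : has_deriv id (fun=> 1).
Proof. by move=> x; exact: is_derive_id. Qed.

Lemma has_derivD f f' g g' : has_deriv f f' -> has_deriv g g' ->
  has_deriv (fun x => f x + g x) (fun x => f' x + g' x).
Proof. by move=> df dg x; exact: (is_deriveD (df x) (dg x)). Qed.

Lemma has_derivN f f' : has_deriv f f' -> has_deriv (fun x => - f x) (fun x => - f' x).
Proof. by move=> df x; exact: (is_deriveN (df x)). Qed.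

Lemma has_derivB f f' g g' : has_deriv f f' -> has_deriv g g' ->
  has_deriv (fun x => f x - g x) (fun x => f' x - g' x).
Proof. by move=> df dg; apply: has_derivD => //; exact: has_derivN. Qed.

Lemma has_derivM f f' g g' : has_deriv f f' -> has_deriv g g' ->
  has_deriv (fun x => f x * g x) (fun x => f' x * g x + f x * g' x).
Proof.
move=> df dg x; rewrite addrC [f' x * g x]mulrC.
exact: (is_deriveM (df x) (dg x)).
Qed.

Lemma has_derivZ f f' (k : R) : has_deriv f f' ->
  has_deriv (fun x => k * f x) (fun x => k * f' x).
Proof. by move=> df x; exact: (is_deriveZ k (df x)). Qed.

Lemma has_deriv_comp f f' g g' : has_deriv f f' -> has_deriv g g' ->
  has_deriv (fun x => f (g x)) (fun x => f' (g x) * g' x).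
Proof. by move=> df dg x; exact: (is_derive1_comp (df (g x)) (dg x)). Qed.

Lemma has_deriv_eq f f' g g' : has_deriv f f' -> f =1 g -> f' =1 g' ->
  has_deriv g g'.
Proof. by move=> df /funext <- e x; rewrite -e. Qed.

Lemma has_deriv_expR : has_deriv expR expR.
Proof. by move=> x; exact: is_derive_expR. Qed.

Lemma has_deriv_cos : has_deriv cos (fun x => - sin x).
Proof. by move=> x; exact: is_derive_cos. Qed.

Lemma has_deriv_sin : has_deriv sin cos.
Proof. by move=> x; exact: is_derive_sin. Qed.

Lemma has_deriv_derivable f f' : has_deriv f f' -> forall x, derivable f x 1.
Proof. by move=> df x; have [] := df x. Qed.

Lemma has_derivE f f' : has_deriv f f' -> derive1 f = f'.
Proof. by move=> df; apply/funext => x; rewrite derive1E; have [_ ->] := df x. Qed.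

End Deriv.

(** * The Poisson kernel and the cosine and sine transforms *)

Section PoissonKernel.
Context {R : realType}.
Local Notation leb := (@lebesgue_measure R).
Implicit Types A x : R.

(** The half-plane Poisson kernel at height 1 / A without its factor 1 / pi: the integral is pi for
    every A > 0, and the mass concentrates at 0 as A grows. *)
Definition poisson A x : R := A / (1 + (A * x) ^+ 2).

(** Abel summation weight: it makes frequency integrals converge, tends to 1 on [0, +oo) as A grows,
    and has [poisson A] as its cosine transform. *)
Definition abel_weight A : R -> R := (fun v => expR (- (A^-1 * v))) \_ `[0, +oo[.

Lemma poisson_den_gt0 x : 0 < 1 + x ^+ 2.
Proof. by rewrite ltr_wpDr// sqr_ge0. Qed.

Lemma continuous_poisson A : continuous (poisson A).
Proof.
move=> x; apply: (@continuousM _ _ (fun=> A) (fun x => (1 + (A * x) ^+ 2)^-1)).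
  exact: cst_continuous.
apply: (@continuousV _ _ (fun x => 1 + (A * x) ^+ 2)).
  by rewrite gt_eqF// poisson_den_gt0.
move: x; apply: has_deriv_continuous; apply: has_derivD; first exact: has_deriv_cst.
by apply: has_derivM; apply: has_derivZ; exact: has_deriv_id.
Qed.

Lemma measurable_poisson A : measurable_fun setT (poisson A).
Proof. by apply: continuous_measurable_fun; exact: continuous_poisson. Qed.

Lemma poisson_ge0 A x : 0 <= A -> 0 <= poisson A x.
Proof. by move=> A0; rewrite divr_ge0// ltW// poisson_den_gt0. Qed.

Lemma poissonN A x : poisson A (- x) = poisson A x.
Proof. by rewrite /poisson mulrN sqrrN. Qed.

Lemma integral_poisson1 : (\int[leb]_x (poisson 1 x)%:E = (pi : R)%:E)%E.
Proof.
rewrite ge0_symfun_integralT.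
- rewrite -set_itvcy.
  transitivity (2%:E * \int[leb]_(x in `[0%R, +oo[) (oneDsqr x)^-1%:E)%E.
    by congr (_ * _)%E; apply: eq_integral => x _; rewrite /poisson /oneDsqr !mul1r.
  by rewrite integral0y_oneDsqr -EFinM mulrCA divff// mulr1.
- by move=> x; exact: poisson_ge0.
- exact: continuous_poisson.
- by move=> x /=; rewrite poissonN.
Qed.

Lemma integral_poisson A s : 0 < A ->
  (\int[leb]_t (poisson A (s - t))%:E = (pi : R)%:E)%E.
Proof.
move=> A0.
have p0 x : (0 <= (poisson A x)%:E)%E by rewrite lee_fin poisson_ge0// ltW.
have mp : measurable_fun setT (fun t : R => poisson A (s - t)).
  by apply: (measurableT_comp (measurable_poisson A)); exact: measurable_funB.
have A'0 : 0 < A^-1 by rewrite invr_gt0.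
rewrite (ge0_integral_affine s A'0)//; last exact/measurable_EFinP.
rewrite -integral_poisson1 -ge0_integralZl//.
- apply: eq_integral => t _; rewrite -EFinM; congr (_%:E).
  rewrite opprD addrCA subrr addr0 poissonN /poisson mul1r.
  by rewrite !mulrA mulVf ?divff ?gt_eqF// !mul1r.
- apply/measurable_EFinP; apply: (measurableT_comp mp) => /=.
  by apply: measurable_funD => //; exact: measurable_funM.
- by rewrite lee_fin invr_ge0 ltW.
Qed.

(** The primitive is the real part of exp ((- e + i x) v) / (- e + i x). *)
Lemma abel_cos_primitive e x : 0 < e ->
  has_deriv (fun v => expR (- (e * v)) *
               ((e ^+ 2 + x ^+ 2)^-1 * (x * sin (v * x) - e * cos (v * x))))
            (fun v => expR (- (e * v)) * cos (v * x)).
Proof.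
move=> e0; have hx : has_deriv (fun v => v * x) (fun=> x).
  apply: (has_deriv_eq (has_derivM has_deriv_id (has_deriv_cst x))) => // v.
  by rewrite mul1r mulr0 addr0.
have he : has_deriv (fun v => - (e * v)) (fun=> - (e * 1)).
  exact/has_derivN/has_derivZ/has_deriv_id.
have hs := has_deriv_comp has_deriv_sin hx.
have hc := has_deriv_comp has_deriv_cos hx.
have hE := has_deriv_comp has_deriv_expR he.
have h := has_derivM hE (has_derivZ (e ^+ 2 + x ^+ 2)^-1
  (has_derivB (has_derivZ x hs) (has_derivZ e hc))).
apply: (has_deriv_eq h) => // v /=; field.
by rewrite gt_eqF// ltr_pwDl ?exprn_gt0// sqr_ge0.
Qed.

Lemma cvg_expRZ e : 0 < e -> (fun v : R => expR (- (e * v))) @ +oo --> (0 : R).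
Proof.
move=> e0; apply: (@cvg_comp _ _ _ (fun v => e * v) (fun z => expR (- z)) _ (pinfty_nbhs R)).
  exact: gt0_cvgMry.
exact: cvgr_expR.
Qed.

Lemma abel_cos_primitive_cvg e x : 0 < e ->
  (fun v : R => expR (- (e * v)) *
    ((e ^+ 2 + x ^+ 2)^-1 * (x * sin (v * x) - e * cos (v * x))))
  @ +oo --> (0 : R).
Proof.
move=> e0; set k := (e ^+ 2 + x ^+ 2)^-1.
have k0 : 0 <= k by rewrite invr_ge0 addr_ge0 ?sqr_ge0.
pose M := k * (`|x| + e).
have bnd v : `|k * (x * sin (v * x) - e * cos (v * x))| <= M.
  rewrite normrM (ger0_norm k0) ler_wpM2l// (le_trans (ler_normB _ _))// !normrM.
  rewrite (gtr0_norm e0) lerD// ler_piMr// ?(ltW e0)//.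
    by rewrite ler_norml sin_geN1 sin_le1.
  by rewrite ler_norml cos_geN1 cos_le1.
have eM : (fun v => M * expR (- (e * v))) @ +oo --> (0 : R).
  by rewrite -[X in _ --> X](mulr0 M); apply: cvgMl_tmp; exact: cvg_expRZ.
have eMN : (fun v => - (M * expR (- (e * v)))) @ +oo --> (0 : R).
  by rewrite -[X in _ --> X]oppr0; exact: cvgN.
apply: squeeze_cvgr eMN eM; apply: nearW => v.
rewrite -ler_norml normrM (ger0_norm (expR_ge0 _)) mulrC.
by rewrite ler_wpM2r ?expR_ge0.
Qed.

(** The summand 1 keeps the integrand nonnegative, as the fundamental theorem on [0, +oo) used here
    demands; [integral_abel_cos] subtracts it again. The primitive is the sum of those at
    frequencies 0 and x. *)
Lemma integral_abel_cosD1 e x : 0 < e ->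
  (\int[leb]_(v in `[0%R, +oo[) (expR (- (e * v)) * (1 + cos (v * x)))%:E =
   (e^-1 + e / (e ^+ 2 + x ^+ 2))%:E)%E.
Proof.
move=> e0.
have h := has_derivD (abel_cos_primitive 0 e0) (abel_cos_primitive x e0).
have hc : continuous (fun v => expR (- (e * v)) * (1 + cos (v * x))).
  apply: (@has_deriv_continuous _ _ _ (has_derivM (has_deriv_comp has_deriv_expR
    (has_derivN (has_derivZ e has_deriv_id))) (has_derivD (has_deriv_cst 1)
    (has_deriv_comp has_deriv_cos (has_derivM has_deriv_id (has_deriv_cst x)))))).
set F := fun v => _ in h.
have l : F @ +oo --> (0 + 0 : R).
  exact: (cvgD (@abel_cos_primitive_cvg e 0 e0) (@abel_cos_primitive_cvg e x e0)).
rewrite (@ge0_continuous_FTC2y _ _ F _ (0 + 0))//.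
- rewrite /F !mulr0 !mul0r !oppr0 expR0 sin0 cos0 !expr0n/= !addr0 !mul1r !mulr1.
  rewrite mulr0 !sub0r -EFinB; congr (_%:E); field.
  by rewrite !gt_eqF// ltr_pwDl ?exprn_gt0// sqr_ge0.
- exact: continuous_subspaceT.
- by apply: cvg_at_right_filter; exact: (has_deriv_continuous h).
- move=> v _; rewrite (has_derivE h).
  by rewrite mulr0 cos0 mulr1 mulrDr mulr1.
Qed.

(** Integrability and total mass A of the weight are inherited from the exponential density of rate
    1 / A. *)
Lemma abel_weightE A v : 0 < A ->
  abel_weight A v = A * exponential_pdf A^-1 v.
Proof.
move=> A0; rewrite /abel_weight /exponential_pdf !patchE.
case: ifP => _; last by rewrite mulr0.
by rewrite mulNr mulrA divff ?gt_eqF// mul1r.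
Qed.

Lemma integrable_abel A : 0 < A -> leb.-integrable setT (EFin \o abel_weight A).
Proof.
move=> A0; have -> : EFin \o abel_weight A =
    (fun v => A%:E * (exponential_pdf A^-1 v)%:E)%E.
  by apply/funext => v /=; rewrite abel_weightE.
apply: integrableZl => //; apply: integrable_exponential_pdf => //.
by rewrite invr_gt0.
Qed.

Lemma integral_abel A : 0 < A -> \int[leb]_v abel_weight A v = A.
Proof.
move=> A0; rewrite /Rintegral.
under eq_integral do rewrite abel_weightE// EFinM.
rewrite ge0_integralZl//.
- by rewrite integral_exponential_pdf ?invr_gt0// mule1.
- by apply/measurable_EFinP; exact: measurable_exponential_pdf.
- by move=> x _; rewrite lee_fin exponential_pdf_ge0// invr_ge0 ltW.
- by rewrite lee_fin ltW.
Qed.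

Lemma measurable_abel A : measurable_fun setT (abel_weight A).
Proof.
apply/(measurable_restrictT _ _).1 => //.
apply: measurable_funTS; apply: (measurableT_comp (@measurable_expR R)).
by apply: measurable_funN; exact: measurable_funM.
Qed.

Lemma integral_abel_cos A x : 0 < A ->
  \int[leb]_v (abel_weight A v * cos (v * x)) = poisson A x.
Proof.
move=> A0; have iA := integrable_abel A0.
have mc : measurable_fun setT (fun v : R => cos (v * x)).
  apply: continuous_measurable_fun.
  exact: (has_deriv_continuous (has_deriv_comp has_deriv_cos
    (has_derivM has_deriv_id (has_deriv_cst x)))).
have iC : leb.-integrable setT (EFin \o (fun v => abel_weight A v * cos (v * x))).
  apply: (le_integrable _ _ _ iA) => //.
    by apply/measurable_EFinP; apply: measurable_funM => //; exact: measurable_abel.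
  move=> v _ /=; rewrite lee_fin normrM ler_piMr//.
  by rewrite ler_norml cos_geN1 cos_le1.
have : \int[leb]_v (abel_weight A v * (1 + cos (v * x))) = A + poisson A x.
  rewrite /Rintegral; under eq_integral do rewrite /abel_weight.
  transitivity (fine (\int[leb]_(v in `[0%R, +oo[)
      (expR (- (A^-1 * v)) * (1 + cos (v * x)))%:E)%E).
    rewrite [in RHS]integral_mkcond; congr fine; apply: eq_integral => v _.
    by rewrite !patchE; case: ifP => // _; rewrite mul0r.
  rewrite integral_abel_cosD1 ?invr_gt0//= invrK; congr (_ + _).
  by rewrite /poisson; field; rewrite (gt_eqF A0) gt_eqF// poisson_den_gt0.
have -> : \int[leb]_v (abel_weight A v * (1 + cos (v * x))) =
    \int[leb]_v (abel_weight A v + abel_weight A v * cos (v * x)).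
  by apply: eq_Rintegral => v _; rewrite mulrDr mulr1.
by rewrite RintegralD// integral_abel// => /addrI.
Qed.

End PoissonKernel.

(** * Integrals against a bounded measurable kernel *)

Section BoundedKernel.
Context {R : realType}.
Local Notation leb := (@lebesgue_measure R).
Local Notation mR := (measurableTypeR R).
Local Notation L1 f := (leb.-integrable setT (EFin \o f)).

Lemma L1_measurable (f : R -> R) : L1 f -> measurable_fun setT f.
Proof. by move=> /integrableP[/measurable_EFinP]. Qed.

Lemma L1_mulr_bounded (f k : R -> R) (M : R) : L1 f -> measurable_fun setT k ->
  (forall x, `|k x| <= M) -> L1 (fun x => f x * k x).
Proof.
move=> f1 mk kM; have mf := L1_measurable f1.
apply: (le_integrable measurableT _ _ (integrableZl measurableT M f1)).
- by apply/measurable_EFinP; exact: measurable_funM.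
- move=> x _ /=; rewrite lee_fin !normrM mulrC ler_wpM2r//.
  by rewrite (le_trans (kM x))// ler_norm.
Qed.

Lemma L1Z (f : R -> R) (k : R) : L1 f -> L1 (fun x => k * f x).
Proof. by move=> f1; exact: (integrableZl measurableT k f1). Qed.

Lemma L1D (f g : R -> R) : L1 f -> L1 g -> L1 (fun x => f x + g x).
Proof. by move=> f1 g1; exact: (integrableD measurableT f1 g1). Qed.

Section fubini.
Variables (g : R -> R) (k : mR * mR -> R) (M : R).
Hypotheses (g1 : L1 g) (mk : measurable_fun setT k) (kM : forall z, `|k z| <= M).

Let mg : measurable_fun setT g. Proof. exact: L1_measurable. Qed.

Lemma kernel_measurable_section x : measurable_fun setT (fun y : R => k (x, y)).
Proof. exact: measurableT_comp. Qed.

Lemma L1_kernel x : L1 (fun y => g y * k (x, y)).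
Proof. exact: (L1_mulr_bounded g1 (kernel_measurable_section x)). Qed.

Lemma kernel_bound x : `|\int[leb]_y (g y * k (x, y))| <= M * \int[leb]_y `|g y|.
Proof.
rewrite (le_trans (le_normr_Rintegral _ _))//; first exact: L1_kernel.
have ag : L1 (fun y => `|g y|) by exact: integrable_norm.
rewrite -RintegralZl//; apply: le_Rintegral => //.
- exact: (integrable_norm (L1_kernel x)).
- exact: L1Z.
- by move=> y _; rewrite normrM mulrC ler_wpM2r.
Qed.

Let mgk : measurable_fun setT (fun z : mR * mR => g z.2 * k z).
Proof. by apply: measurable_funM => //; exact: measurableT_comp. Qed.

(** Tonelli gives measurability for nonnegative integrands, so the integrand is split into its
    positive and negative parts. *)
Lemma measurable_kernel_integral :
  measurable_fun setT (fun x : R => \int[leb]_y (g y * k (x, y))).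
Proof.
pose H (z : mR * mR) := (g z.2 * k z)%:E.
have mH : measurable_fun setT H by exact/measurable_EFinP.
apply: (measurableT_comp (@fine_measurable R setT measurableT)).
have -> : (fun x : R => \int[leb]_y (g y * k (x, y))%:E)%E =
    (fun x => \int[leb]_y H^\+ (x, y) - \int[leb]_y H^\- (x, y))%E.
  apply/funext => x; transitivity (\int[leb]_y (H \o pair x) y)%E => //.
  by rewrite integralE funepos_comp funeneg_comp.
apply: emeasurable_funB.
- apply: (measurable_fun_fubini_tonelli_F (fun z => H^\+ z)%E) => //.
  exact: measurable_funepos.
- apply: (measurable_fun_fubini_tonelli_F (fun z => H^\- z)%E) => //.
  exact: measurable_funeneg.
Qed.

(** The function f x * g y * k (x, y) is dominated by M * |f x| * |g y|, hence integrable on the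
    plane, and Fubini applies. *)
Lemma bounded_kernel_fubini (f : R -> R) : L1 f ->
  \int[leb]_x (f x * \int[leb]_y (g y * k (x, y))) =
  \int[leb]_y (g y * \int[leb]_x (f x * k (x, y))).
Proof.
move=> f1; have mf := L1_measurable f1.
pose H (z : mR * mR) := (f z.1 * (g z.2 * k z))%:E.
have mH : measurable_fun setT H.
  by apply/measurable_EFinP; apply: measurable_funM => //; exact: measurableT_comp.
have kf1 y : L1 (fun x => f x * k (x, y)).
  apply: (L1_mulr_bounded f1 _ (fun x => kM (x, y))).
  exact: measurableT_comp.
have iH : ((leb : {sigma_finite_measure set mR -> \bar R}) \x
    (leb : {sigma_finite_measure set mR -> \bar R}))%E.-integrable setT H.
  apply/integrable12ltyP => //.
  set K := (M * \int[leb]_y `|g y|)%:E.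
  apply: (@le_lt_trans _ _ (\int[leb]_x (K * `|(f x)%:E|))%E).
    apply: ge0_le_integral => //.
    - by move=> x _; exact: integral_ge0.
    - apply: (measurable_fun_fubini_tonelli_F (fun z => `|H z|)%E) => //.
      exact: measurableT_comp.
    - apply: measurable_funeM; apply: measurableT_comp => //.
      exact/measurable_EFinP.
    - move=> x _.
      have -> : (\int[leb]_y `|H (x, y)| =
          `|(f x)%:E| * \int[leb]_y `|(g y * k (x, y))%:E|)%E.
        rewrite -ge0_integralZl//; last first.
          apply: measurableT_comp => //.
          by have /integrableP[] := L1_kernel x.
        by apply: eq_integral => y _; rewrite /H EFinM abseM.
      rewrite muleC lee_wpmul2r//.
      apply: (@le_trans _ _ (\int[leb]_y (M%:E * `|(g y)%:E|))%E).
        apply: ge0_le_integral => //.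
        - apply: measurableT_comp => //.
          by have /integrableP[] := L1_kernel x.
        - apply: measurable_funeM; apply: measurableT_comp => //.
          exact/measurable_EFinP.
        - by move=> y _ /=; rewrite lee_fin normrM mulrC ler_wpM2r.
      rewrite integralZl//; last exact: integrable_abse.
      rewrite /K EFinM /Rintegral fineK//.
      have /integrableP[_] := g1.
      by rewrite ge0_fin_numE// integral_ge0.
  rewrite integralZl//; last exact: integrable_abse.
  have /integrableP[_] := f1.
  by move=> h; rewrite lte_mul_pinfty// ?integral_ge0// lee_fin mulr_ge0//
    ?Rintegral_ge0// (le_trans _ (kM (0,0))).
have := Fubini iH.
rewrite /Rintegral => h; congr fine.
transitivity (\int[leb]_x \int[leb]_y H (x, y))%E.
  apply: eq_integral => x _; rewrite EFinM fineK.
    by rewrite -integralZl//; exact: (L1_kernel x).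
  by apply: integrable_fin_num => //; exact: (L1_kernel x).
rewrite h; apply: eq_integral => y _; rewrite EFinM fineK.
  rewrite -integralZl//; last exact: (kf1 y).
  by apply: eq_integral => x _; rewrite /H mulrCA.
by apply: integrable_fin_num => //; exact: (kf1 y).
Qed.

End fubini.

End BoundedKernel.

(** * The Abel-weighted Parseval identity *)

Section WeightedParseval.
Context {R : realType}.
Local Notation leb := (@lebesgue_measure R).
Local Notation mR := (measurableTypeR R).
Local Notation L1 f := (leb.-integrable setT (EFin \o f)).

(** The Fourier transform of a real [g] is [cosT g v - i sinT g v]; with these two the argument
    stays in real arithmetic. *)
Definition cosT (g : R -> R) (v : R) : R := \int[leb]_t (g t * cos (v * t)).
Definition sinT (g : R -> R) (v : R) : R := \int[leb]_t (g t * sin (v * t)).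

Lemma cos_norm_le1 (x : R) : `|cos x| <= 1.
Proof. by rewrite ler_norml cos_geN1 cos_le1. Qed.

Lemma sin_norm_le1 (x : R) : `|sin x| <= 1.
Proof. by rewrite ler_norml sin_geN1 sin_le1. Qed.

Lemma measurable_cos : measurable_fun setT (@cos R).
Proof.
by apply: continuous_measurable_fun; exact: (has_deriv_continuous (@has_deriv_cos R)).
Qed.

Lemma measurable_sin : measurable_fun setT (@sin R).
Proof.
by apply: continuous_measurable_fun; exact: (has_deriv_continuous (@has_deriv_sin R)).
Qed.

Lemma measurable_cos2 : measurable_fun setT (fun z : mR * mR => cos (z.1 * z.2)).
Proof. by apply: (measurableT_comp measurable_cos); exact: measurable_funM. Qed.

Lemma measurable_sin2 : measurable_fun setT (fun z : mR * mR => sin (z.1 * z.2)).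
Proof. by apply: (measurableT_comp measurable_sin); exact: measurable_funM. Qed.

Section transform.
Variables (g : R -> R).
Hypothesis g1 : L1 g.

Lemma measurable_cosT : measurable_fun setT (cosT g).
Proof. exact: (measurable_kernel_integral g1 measurable_cos2). Qed.

Lemma measurable_sinT : measurable_fun setT (sinT g).
Proof. exact: (measurable_kernel_integral g1 measurable_sin2). Qed.

Lemma L1_cos v : L1 (fun t => g t * cos (v * t)).
Proof.
apply: (L1_mulr_bounded g1 _ (fun t => cos_norm_le1 (v * t))).
by apply: (measurableT_comp measurable_cos); exact: measurable_funM.
Qed.

Lemma L1_sin v : L1 (fun t => g t * sin (v * t)).
Proof.
apply: (L1_mulr_bounded g1 _ (fun t => sin_norm_le1 (v * t))).
by apply: (measurableT_comp measurable_sin); exact: measurable_funM.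
Qed.

Lemma cosT_bound v : `|cosT g v| <= \int[leb]_t `|g t|.
Proof.
rewrite -[leRHS]mul1r.
exact: (kernel_bound g1 measurable_cos2 (fun z => cos_norm_le1 _) v).
Qed.

Lemma sinT_bound v : `|sinT g v| <= \int[leb]_t `|g t|.
Proof.
rewrite -[leRHS]mul1r.
exact: (kernel_bound g1 measurable_sin2 (fun z => sin_norm_le1 _) v).
Qed.

Lemma cosTB v s : \int[leb]_t (g t * cos (v * (s - t))) =
  cos (v * s) * cosT g v + sin (v * s) * sinT g v.
Proof.
rewrite /cosT /sinT -!RintegralZl//; [|exact: L1_sin|exact: L1_cos].
rewrite -RintegralD//; [|exact/L1Z/L1_cos|exact/L1Z/L1_sin].
by apply: eq_Rintegral => t _; rewrite mulrBr cosB; ring.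
Qed.

End transform.

(** The sum of products is the double integral of f s * g t * cos (v * (s - t)). Integrating first
    in v, by two uses of Fubini, turns the cosine into the Poisson kernel at s - t. *)
Lemma weighted_parseval (A : R) (f g : R -> R) : 0 < A -> L1 f -> L1 g ->
  \int[leb]_v (abel_weight A v * (cosT f v * cosT g v + sinT f v * sinT g v)) =
  \int[leb]_s (f s * \int[leb]_t (g t * poisson A (s - t))).
Proof.
move=> A0 f1 g1; set G := \int[leb]_t `|g t|.
(* By [cosTB], [q (v, s)] is the integral over t of g t * cos (v * (s - t)). *)
pose q (z : mR * mR) := cos (z.1 * z.2) * cosT g z.1 + sin (z.1 * z.2) * sinT g z.1.
have mq : measurable_fun setT q.
  apply: measurable_funD; apply: measurable_funM.
  - exact: measurable_cos2.
  - exact: (measurableT_comp (measurable_cosT g1)).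
  - exact: measurable_sin2.
  - exact: (measurableT_comp (measurable_sinT g1)).
have qb z : `|q z| <= G + G.
  rewrite (le_trans (ler_normD _ _))// !normrM lerD//.
    by rewrite -[G]mul1r ler_pM// ?cos_norm_le1 ?cosT_bound.
  by rewrite -[G]mul1r ler_pM// ?sin_norm_le1 ?sinT_bound.
transitivity (\int[leb]_v (abel_weight A v * \int[leb]_s (f s * q (v, s)))).
  apply: eq_Rintegral => v _; congr (_ * _).
  rewrite mulrC [X in _ + X]mulrC /cosT -/(cosT g v) /sinT -/(sinT g v).
  rewrite -!RintegralZl//; [|exact: L1_sin|exact: L1_cos].
  rewrite -RintegralD//; [|exact/L1Z/L1_cos|exact/L1Z/L1_sin].
  by apply: eq_Rintegral => s _; rewrite /q /=; ring.
rewrite (bounded_kernel_fubini f1 mq qb (integrable_abel A0)).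
apply: eq_Rintegral => s _; congr (_ * _).
pose k (z : mR * mR) := cos (z.1 * (s - z.2)).
have mk : measurable_fun setT k.
  apply: (measurableT_comp measurable_cos); apply: measurable_funM => //.
  exact: measurable_funB.
have kb z : `|k z| <= 1 by exact: cos_norm_le1.
transitivity (\int[leb]_v (abel_weight A v * \int[leb]_t (g t * k (v, t)))).
  by apply: eq_Rintegral => v _; rewrite /q/= -cosTB.
rewrite (bounded_kernel_fubini g1 mk kb (integrable_abel A0)).
by apply: eq_Rintegral => t _; rewrite -integral_abel_cos.
Qed.

End WeightedParseval.

(** * A weighted Bessel inequality and the limit of the weights *)

Section PoissonLimit.
Context {R : realType}.
Local Notation leb := (@lebesgue_measure R).
Local Notation mR := (measurableTypeR R).
Local Notation L1 f := (leb.-integrable setT (EFin \o f)).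

Lemma ae_lebS (P Q : R -> Prop) : (forall x, P x -> Q x) ->
  {ae leb, forall x, P x} -> {ae leb, forall x, Q x}.
Proof. by move=> PQ; exact: (@filterS _ _ (ae_filter_ringOfSetsType leb)). Qed.

Lemma ae_lebI (P Q : R -> Prop) : {ae leb, forall x, P x} ->
  {ae leb, forall x, Q x} -> {ae leb, forall x, P x /\ Q x}.
Proof. exact: (@filterI _ _ (ae_filter_ringOfSetsType leb)). Qed.

Lemma EFin_Rintegral (f : R -> R) : L1 f ->
  ((\int[leb]_x f x)%:E = \int[leb]_x (f x)%:E)%E.
Proof. by move=> f1; rewrite /Rintegral fineK//; exact: integrable_fin_num. Qed.

Lemma poisson_le (A x : R) : 0 <= A -> `|poisson A x| <= A.
Proof.
move=> A0; rewrite ger0_norm ?poisson_ge0// /poisson ler_pdivrMr ?poisson_den_gt0//.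
by rewrite ler_peMr// lerDl sqr_ge0.
Qed.

Lemma measurable_poissonB (A : R) :
  measurable_fun setT (fun z : mR * mR => poisson A (z.1 - z.2)).
Proof.
by apply: (measurableT_comp (measurable_poisson A)); exact: measurable_funB.
Qed.

Lemma L1_poissonB (A s : R) : 0 < A -> L1 (fun t => poisson A (s - t)).
Proof.
move=> A0; apply/integrableP; split.
  apply/measurable_EFinP.
  by apply: (measurableT_comp (measurable_poisson A)); exact: measurable_funB.
under eq_integral do rewrite /= ger0_norm ?poisson_ge0 ?(ltW A0)//.
by rewrite integral_poisson// ltry.
Qed.

Lemma integral_poissonC (A t : R) : 0 < A ->
  (\int[leb]_s (poisson A (s - t))%:E = (pi : R)%:E)%E.
Proof.
move=> A0; rewrite -(integral_poisson t A0); apply: eq_integral => s _.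
by rewrite -poissonN opprB.
Qed.

(* Schur test: [f s * f t] is bounded by the mean of the squares. *)
Lemma weighted_bessel (A : R) (f : R -> R) : 0 < A -> L1 f ->
  L1 (fun x => f x ^+ 2) ->
  \int[leb]_v (abel_weight A v * (cosT f v ^+ 2 + sinT f v ^+ 2)) <=
  pi * \int[leb]_s f s ^+ 2.
Proof.
move=> A0 f1 f2.
have mP := measurable_poissonB A.
have bP (z : mR * mR) : `|poisson A (z.1 - z.2)| <= A by exact/poisson_le/ltW.
have P0 x : 0 <= poisson A x by rewrite poisson_ge0// ltW.
rewrite (_ : \int[leb]_v _ =
  \int[leb]_s (f s * \int[leb]_t (f t * poisson A (s - t)))); last first.
  by rewrite -weighted_parseval.
pose J s := \int[leb]_t (f t ^+ 2 * poisson A (s - t)).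
have mJ : measurable_fun setT J by exact: (measurable_kernel_integral f2 mP).
have mI : measurable_fun setT (fun s : R => \int[leb]_t (f t * poisson A (s - t))).
  exact: (measurable_kernel_integral f1 mP).
have J0 s : 0 <= J s by apply: Rintegral_ge0 => t _; rewrite mulr_ge0 ?sqr_ge0.
have intJ : (\int[leb]_s (J s)%:E = (pi * \int[leb]_s f s ^+ 2)%:E)%E.
  transitivity (\int[leb]_s \int[leb]_t (f t ^+ 2 * poisson A (s - t))%:E)%E.
    by apply: eq_integral => s _; rewrite EFin_Rintegral//; exact: (L1_kernel f2 mP bP s).
  have mH : measurable_fun setT
      (fun z : mR * mR => (f z.2 ^+ 2 * poisson A (z.1 - z.2))%:E).
    apply/measurable_EFinP; apply: measurable_funM => //.
    exact: (measurableT_comp (L1_measurable f2)).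
  rewrite (fubini_tonelli (fun z : mR * mR => (f z.2 ^+ 2 * poisson A (z.1 - z.2))%:E)) //;
    last by move=> z; rewrite lee_fin mulr_ge0 ?sqr_ge0.
  rewrite EFinM EFin_Rintegral// -integralZl//; apply: eq_integral => t _ /=.
  under eq_integral do rewrite EFinM.
  rewrite ge0_integralZl ?lee_fin ?sqr_ge0//.
  - by rewrite integral_poissonC// -EFinM mulrC.
  - apply/measurable_EFinP.
    by apply: (measurableT_comp (measurable_poisson A)); exact: measurable_funB.
  - by move=> s _; rewrite lee_fin.
have iJ : L1 J.
  apply/integrableP; split; first exact/measurable_EFinP.
  under eq_integral do rewrite /= ger0_norm//.
  by rewrite intJ ltry.
have RJ : \int[leb]_s J s = pi * \int[leb]_s f s ^+ 2.
  by rewrite /Rintegral intJ.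
have bnd s : `|f s * \int[leb]_t (f t * poisson A (s - t))| <=
    2^-1 * (pi * f s ^+ 2 + J s).
  have iP := L1_poissonB s A0.
  have Ppi : \int[leb]_t poisson A (s - t) = pi.
    by rewrite /Rintegral integral_poisson.
  have k2 := L1_kernel f2 mP bP s.
  have k1 := L1_kernel f1 mP bP s.
  rewrite -RintegralZl//.
  rewrite (le_trans (le_normr_Rintegral _ _))//; first exact: (L1Z _ k1).
  rewrite [pi * _]mulrC -Ppi -RintegralZl// -RintegralD//; last exact: L1Z.
  rewrite -RintegralZl//; last by apply: L1D; first exact: L1Z.
  apply: le_Rintegral => //.
  - exact: (integrable_norm (L1Z _ k1)).
  - by apply: L1Z; apply: L1D; first exact: L1Z.
  - move=> t _; rewrite mulrA normrM (ger0_norm (P0 _)) -mulrDl mulrA.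
    rewrite ler_wpM2r// ler_norml; apply/andP; split.
      by have := sqr_ge0 (f s + f t); lra.
    by have := sqr_ge0 (f s - f t); lra.
have ib : L1 (fun s => 2^-1 * (pi * f s ^+ 2 + J s)).
  by apply: L1Z; apply: L1D => //; exact: L1Z.
(* Both halves of the mean have the same integral: the first because the kernel has mass pi in t,
   the second by [intJ], where it has mass pi in s. *)
have -> : pi * \int[leb]_s f s ^+ 2 = \int[leb]_s (2^-1 * (pi * f s ^+ 2 + J s)).
  rewrite RintegralZl//; last by apply: L1D => //; exact: L1Z.
  rewrite RintegralD//; last exact: L1Z.
  have half x : 2^-1 * (x + x) = x :> R by lra.
  by rewrite RJ RintegralZl// half.
apply: le_Rintegral => //.
- apply: (le_integrable measurableT _ _ ib).
    apply/measurable_EFinP; apply: measurable_funM => //.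
    exact: L1_measurable.
  move=> s _ /=; rewrite lee_fin (le_trans (bnd s))// ler_norm//.
- by move=> s _; rewrite (le_trans (ler_norm _))// bnd.
Qed.

Lemma L1_affine (a b : R) (f : R -> R) : 0 < a -> L1 f ->
  L1 (fun x => f (a * x + b)).
Proof.
move=> a0 f1; have mf := L1_measurable f1.
have maf : measurable_fun setT (fun x : R => f (a * x + b)).
  by apply: (measurableT_comp mf); apply: measurable_funD => //; exact: measurable_funM.
apply/integrableP; split; first exact/measurable_EFinP.
have /integrableP[_] := f1.
rewrite (ge0_integral_affine b a0)//; last first.
  by apply: measurableT_comp => //; exact/measurable_EFinP.
set X := (\int[leb]_x `|(EFin \o f) (a * x + b)%R|)%E.
change (a%:E * X < +oo -> X < +oo)%E; case: X => [r| |]//=; first by rewrite !ltry.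
by rewrite gt0_muley// lte_fin.
Qed.

(** The nonnegative change of variables is applied to the positive and negative parts; integrability
    keeps their difference well defined. *)
Lemma Rintegral_affine (a b : R) (f : R -> R) : 0 < a -> L1 f ->
  \int[leb]_x f x = a * \int[leb]_x f (a * x + b).
Proof.
move=> a0 f1; have mf := L1_measurable f1; have af1 := L1_affine b a0 f1.
have mEf : measurable_fun setT (EFin \o f) by exact/measurable_EFinP.
have e : (fun x => (f (a * x + b))%:E) = (EFin \o f) \o (fun x => a * x + b) by [].
apply: EFin_inj; rewrite EFinM !EFin_Rintegral//.
rewrite [LHS]integralE [X in (_ * X)%E]integralE.
rewrite muleBr//; last first.
  rewrite fin_num_adde_defl// fin_numN.
  exact: (integrable_neg_fin_num measurableT af1).
congr (_ - _)%E.
- rewrite (ge0_integral_affine b a0)//; last exact: measurable_funepos.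
  congr (_ * _)%E; apply: eq_integral => x _.
  by rewrite !funeposE.
- rewrite (ge0_integral_affine b a0)//; last exact: measurable_funeneg.
  congr (_ * _)%E; apply: eq_integral => x _.
  by rewrite !funenegE.
Qed.

(** The substitution t = y / A + s moves the parameter from the kernel into [f], so that the fixed
    function M * [poisson 1] dominates for all A. *)
Lemma integral_poisson_scale (A s : R) (f : R -> R) (M : R) : 0 < A ->
  measurable_fun setT f -> (forall x, `|f x| <= M) ->
  \int[leb]_t (f t * poisson A (s - t)) =
  \int[leb]_y (f (A^-1 * y + s) * poisson 1 y).
Proof.
move=> A0 mf fM.
have fP : L1 (fun t => f t * poisson A (s - t)).
  have := L1_mulr_bounded (L1_poissonB s A0) mf fM.
  by apply: eq_integrable => // t _ /=; rewrite mulrC.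
have A'0 : 0 < A^-1 by rewrite invr_gt0.
rewrite (Rintegral_affine s A'0 fP) -RintegralZl//; last exact: (L1_affine s A'0 fP).
apply: eq_Rintegral => y _; rewrite mulrCA; congr (_ * _).
rewrite opprD addrCA subrr addr0 poissonN /poisson !mul1r.
by rewrite !mulrA mulVf ?divff ?gt_eqF// !mul1r.
Qed.

(** Dominated convergence after rescaling. The limit carries the factor pi because the kernel is not
    normalised; the index [k.+1] keeps the parameter positive. *)
Lemma poisson_cvg (f : R -> R) (M s : R) :
  measurable_fun setT f -> (forall x, `|f x| <= M) -> {for s, continuous f} ->
  (fun k : nat => \int[leb]_t (f t * poisson k.+1%:R (s - t))) @ \oo --> f s * pi.
Proof.
move=> mf fM cf.
under eq_cvg do rewrite (integral_poisson_scale _ _ mf fM)//.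
pose f_ (k : nat) (y : R) := (f (k.+1%:R^-1 * y + s) * poisson 1 y)%:E.
have P1 : L1 (fun y => poisson 1 y).
  have := @L1_poissonB 1 0 ltr01.
  by apply: eq_integrable => // y _ /=; rewrite sub0r poissonN.
have mP1 : measurable_fun setT (poisson (1 : R)) by exact: measurable_poisson.
have mf_ k : measurable_fun setT (f_ k).
  have mfk : measurable_fun setT (fun y : R => f (k.+1%:R^-1 * y + s)).
    by apply: (measurableT_comp mf); exact: measurable_funD.
  by apply/measurable_EFinP; exact: (measurable_funM mfk mP1).
have [||||_ _] := @dominated_convergence _ _ _ leb setT measurableT f_
   (fun y => (f s * poisson 1 y)%:E) (fun y => (M * poisson 1 y)%:E) mf_.
- by apply/measurable_EFinP; exact: measurable_funM.
- apply: aeW => y _; apply/fine_cvgP; split; first exact: nearW.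
  have h : (fun k : nat => k.+1%:R^-1 * y + s) @ \oo --> 0 * y + s.
    apply: cvgD; last exact: cvg_cst.
    by apply: cvgM; [exact: cvg_harmonic|exact: cvg_cst].
  rewrite mul0r add0r in h.
  have hf : (fun k : nat => f (k.+1%:R^-1 * y + s)) @ \oo --> f s.
    exact: (cvg_comp _ _ h cf).
  exact: (cvgM hf (cvg_cst _)).
- exact: L1Z.
- apply: aeW => y k _ /=; rewrite lee_fin normrM [X in _ * X]ger0_norm ?poisson_ge0//.
  by rewrite ler_wpM2r ?poisson_ge0.
- have -> : (\int[leb]_y (f s * poisson 1 y)%:E = (f s * pi)%:E)%E.
    rewrite -EFin_Rintegral; last exact: L1Z.
    by rewrite RintegralZl// /Rintegral integral_poisson1.
  by move/fine_cvg.
Qed.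

(** The smoothed [g] stays below M * pi and converges wherever [g] is continuous. Continuity almost
    everywhere is the right demand, since [g] will be a continuous function cut off to [0, T]. *)
Lemma weighted_parseval_cvg (f g : R -> R) (M : R) : L1 f -> L1 g ->
  (forall x, `|g x| <= M) -> {ae leb, forall s, {for s, continuous g}} ->
  (fun k : nat => \int[leb]_v (abel_weight k.+1%:R v *
    (cosT f v * cosT g v + sinT f v * sinT g v)))
  @ \oo --> pi * \int[leb]_s (f s * g s).
Proof.
move=> f1 g1 gM cg; have mf := L1_measurable f1; have mg := L1_measurable g1.
under eq_cvg do rewrite weighted_parseval//.
pose I_ k (s : mR) := \int[leb]_t (g t * poisson k.+1%:R (s - t)).
have mI k : measurable_fun setT (I_ k).
  exact: (measurable_kernel_integral g1 (measurable_poissonB k.+1%:R)).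
have bI k s : `|I_ k s| <= M * pi.
  have A0 : (0 : R) < k.+1%:R by [].
  have h := kernel_bound (L1_poissonB s A0)
    (measurableT_comp mg (@measurable_snd _ _ mR mR)) (fun z => gM z.2) s.
  rewrite /I_ (_ : \int[leb]_t (g t * _) =
    \int[leb]_t (poisson k.+1%:R (s - t) * g t)); last first.
    by apply: eq_Rintegral => t _; rewrite mulrC.
  apply: (le_trans h); rewrite ler_wpM2l ?(le_trans _ (gM 0))//.
  rewrite /Rintegral; under eq_integral do rewrite ger0_norm ?poisson_ge0//.
  by rewrite integral_poisson.
have [|||||_ _] := @dominated_convergence _ _ _ leb setT measurableT
   (fun k s => (f s * I_ k s)%:E)
   (fun s => (f s * (g s * pi))%:E) (fun s => (M * pi * `|f s|)%:E).
- by move=> k; apply/measurable_EFinP; exact: measurable_funM.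
- by apply/measurable_EFinP; apply: measurable_funM => //; exact: measurable_funM.
- move: cg; apply: ae_lebS => s cs _; apply/fine_cvgP; split; first exact: nearW.
  by apply: cvgM; [exact: cvg_cst|exact: (poisson_cvg mg gM cs)].
- exact/L1Z/integrable_norm.
- by apply: aeW => s k _ /=; rewrite lee_fin normrM mulrC ler_wpM2r.
- have fg1 := L1_mulr_bounded f1 mg gM.
  have -> : (\int[leb]_s (f s * (g s * pi))%:E = (pi * \int[leb]_s (f s * g s))%:E)%E.
    rewrite -RintegralZl// EFin_Rintegral; last exact: (L1Z pi fg1).
    by apply: eq_integral => s _; rewrite mulrA mulrC.
  by move/fine_cvg.
Qed.

End PoissonLimit.

(** * The estimate for band-limited functions *)

Section BandEstimate.
Context {R : realType}.
Local Notation leb := (@lebesgue_measure R).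
Local Notation L1 f := (leb.-integrable setT (EFin \o f)).
Implicit Types f phi psi : R -> R.

(** The squared modulus of the Fourier transform of [f] at [v]. *)
Definition energy f v : R := cosT f v ^+ 2 + sinT f v ^+ 2.

Lemma energy_ge0 f v : 0 <= energy f v.
Proof. by rewrite addr_ge0 ?sqr_ge0. Qed.

Lemma measurable_energy f : L1 f -> measurable_fun setT (energy f).
Proof.
move=> f1; apply: measurable_funD; apply: measurable_funX.
  exact: measurable_cosT.
exact: measurable_sinT.
Qed.

Lemma abel_weight_ge0 (A v : R) : 0 <= abel_weight A v.
Proof. by rewrite /abel_weight patchE; case: ifP => // _; exact: expR_ge0. Qed.

Lemma abel_weight_le1 (A v : R) : 0 < A -> abel_weight A v <= 1.
Proof.
move=> A0; rewrite /abel_weight patchE; case: ifPn => // /set_mem/=.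
rewrite in_itv/= andbT => v0; rewrite -expR0 ler_expR oppr_le0.
by rewrite mulr_ge0// invr_ge0 ltW.
Qed.

Lemma abel_weight_lt0 (A v : R) : v < 0 -> abel_weight A v = 0.
Proof.
move=> v0; rewrite /abel_weight patchE ifF//; apply/negbTE; rewrite notin_setE/=.
by rewrite in_itv/= andbT; apply/negP; rewrite -ltNge.
Qed.

Lemma L1_abel_bounded (A M : R) (k : R -> R) : 0 < A -> measurable_fun setT k ->
  (forall v, `|k v| <= M) -> L1 (fun v => abel_weight A v * k v).
Proof. by move=> A0 mk kM; exact: (L1_mulr_bounded (integrable_abel A0) mk kM). Qed.

Lemma L1_abel_energy (A : R) f : 0 < A -> L1 f ->
  L1 (fun v => abel_weight A v * energy f v).
Proof.
move=> A0 f1; set I := \int[leb]_t `|f t|.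
apply: (@L1_abel_bounded _ (I ^+ 2 + I ^+ 2)) => //; first exact: measurable_energy.
have sqr_le (x : R) : `|x| <= I -> x ^+ 2 <= I ^+ 2.
  by move=> xI; rewrite -[x ^+ 2]real_normK ?num_real// lerXn2r ?nnegrE ?(le_trans _ xI).
by move=> v; rewrite ger0_norm ?energy_ge0// lerD// sqr_le ?cosT_bound ?sinT_bound.
Qed.

(** Young's inequality at one frequency. The parameter s stays free; choosing it at the end recovers
    the effect of Cauchy-Schwarz. *)
Lemma band_pointwise (s D fc fs pc ps qc qs : R) : 0 < s ->
  pc ^+ 2 + ps ^+ 2 <= D ^+ 2 * (qc ^+ 2 + qs ^+ 2) ->
  fc * pc + fs * ps <= s / 2 * (fc ^+ 2 + fs ^+ 2) +
    D ^+ 2 / (2 * s) * (qc ^+ 2 + qs ^+ 2).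
Proof.
move=> s0 h.
have e1 : fc * pc + fs * ps <= s / 2 * (fc ^+ 2 + fs ^+ 2) +
    (pc ^+ 2 + ps ^+ 2) / (2 * s).
  have -> : s / 2 * (fc ^+ 2 + fs ^+ 2) + (pc ^+ 2 + ps ^+ 2) / (2 * s) =
      fc * pc + fs * ps + ((s * fc - pc) ^+ 2 + (s * fs - ps) ^+ 2) / (2 * s).
    by field; rewrite gt_eqF.
  by rewrite lerDl divr_ge0 ?addr_ge0 ?sqr_ge0// mulr_ge0// ltW.
apply: (le_trans e1); rewrite lerD2l [leRHS]mulrAC ler_wpM2r// invr_ge0.
by rewrite mulr_ge0// ltW.
Qed.

(** The frequencies are split. On [S], the part outside the band, [f] has little energy and the
    crude terms with l suffice; off [S] the energy of [psi] is controlled by that of [phi]. Bessel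
    then converts the weighted energies back to time integrals. *)
Lemma weighted_band_estimate (A l s D dl : R) (S : set R) f phi psi :
  0 < A -> 0 < l -> 0 < s -> measurable S ->
  L1 f -> L1 (fun x => f x ^+ 2) -> L1 phi -> L1 (fun x => phi x ^+ 2) ->
  L1 psi -> L1 (fun x => psi x ^+ 2) ->
  (forall v, 0 <= v -> ~ S v -> energy psi v <= D ^+ 2 * energy phi v) ->
  (\int[leb]_(v in S) (energy f v)%:E <= dl%:E)%E ->
  \int[leb]_v (abel_weight A v * (cosT f v * cosT psi v + sinT f v * sinT psi v))
  <= l * dl + (pi * \int[leb]_x psi x ^+ 2) / l
     + (s / 2 * (pi * \int[leb]_x f x ^+ 2)
     + D ^+ 2 / (2 * s) * (pi * \int[leb]_x phi x ^+ 2)).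
Proof.
move=> A0 l0 s0 mS f1 f2 phi1 phi2 psi1 psi2 hS hdl.
pose w := abel_weight A.
have cs : 0 <= s / 2 by rewrite divr_ge0// ltW.
have cD : 0 <= D ^+ 2 / (2 * s) by rewrite divr_ge0 ?sqr_ge0// mulr_ge0// ltW.
have mSf : measurable_fun setT (energy f \_ S).
  exact: ((measurable_restrictT _ mS).1 (measurable_funTS (measurable_energy f1))).
have iS : L1 (energy f \_ S).
  apply/integrableP; split.
    exact/measurable_EFinP.
  apply: le_lt_trans (ltry dl); apply: le_trans hdl.
  rewrite [leRHS]integral_mkcond; apply: ge0_le_integral => //.
  - by apply: measurableT_comp => //; exact/measurable_EFinP.
  - have mE : measurable_fun setT (EFin \o energy f).
      by apply/measurable_EFinP; exact: measurable_energy.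
    exact: ((measurable_restrictT _ mS).1 (measurable_funTS mE)).
  - move=> v _ /=; rewrite !patchE; case: ifP => _; last by rewrite normr0.
    by rewrite lee_fin ger0_norm ?energy_ge0.
have Sdl : \int[leb]_v (energy f \_ S) v <= dl.
  rewrite -lee_fin EFin_Rintegral//; apply: le_trans hdl.
  rewrite [leRHS]integral_mkcond le_eqVlt; apply/orP; left; apply/eqP.
  by apply: eq_integral => v _; rewrite !patchE; case: ifP.
have wf := L1_abel_energy A0 f1; have wphi := L1_abel_energy A0 phi1.
have wpsi := L1_abel_energy A0 psi1.
have i1 : L1 (fun v => l * (energy f \_ S) v + l^-1 * (w v * energy psi v)).
  by apply: L1D; apply: L1Z.
have i2 : L1 (fun v => s / 2 * (w v * energy f v) +
    D ^+ 2 / (2 * s) * (w v * energy phi v)).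
  by apply: L1D; apply: L1Z.
apply: (@le_trans _ _ (\int[leb]_v
  ((l * (energy f \_ S) v + l^-1 * (w v * energy psi v)) +
   (s / 2 * (w v * energy f v) + D ^+ 2 / (2 * s) * (w v * energy phi v))))).
  apply: le_Rintegral => //.
  - set If := \int[leb]_t `|f t|; set Ip := \int[leb]_t `|psi t|.
    apply: (@L1_abel_bounded A (If * Ip + If * Ip)) => //.
      by apply: measurable_funD; apply: measurable_funM;
        do ?[exact: measurable_cosT|exact: measurable_sinT].
    move=> v; rewrite (le_trans (ler_normD _ _))// !normrM.
    by rewrite lerD// ler_pM// ?cosT_bound ?sinT_bound.
  - exact: L1D.
  (* At negative frequencies the weight vanishes: the left side is 0 and the right side is
     nonnegative. *)
  move=> v _; have [v0|v0] := ltP v 0.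
    rewrite /w abel_weight_lt0// !mul0r !mulr0 !addr0 mulr_ge0 ?(ltW l0)//.
    by rewrite patchE; case: ifP => // _; rewrite energy_ge0.
  have w0 : 0 <= w v by exact: abel_weight_ge0.
  have w1 : w v <= 1 by exact: abel_weight_le1.
  rewrite patchE; case: ifPn => [/set_mem Sv|/negP Sv].
    rewrite (@le_trans _ _ (w v * (l * energy f v + l^-1 * energy psi v)))//.
      rewrite ler_wpM2l// /energy.
      have -> : l * (cosT f v ^+ 2 + sinT f v ^+ 2) +
          l^-1 * (cosT psi v ^+ 2 + sinT psi v ^+ 2) =
        (cosT f v * cosT psi v + sinT f v * sinT psi v) +
        ((l * cosT f v - cosT psi v) ^+ 2 + (l * sinT f v - sinT psi v) ^+ 2 +
         (l * cosT f v) ^+ 2 + (l * sinT f v) ^+ 2 +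
         cosT psi v ^+ 2 + sinT psi v ^+ 2) / (2 * l).
        by field; rewrite gt_eqF.
      rewrite lerDl divr_ge0 ?mulr_ge0 ?(ltW l0)//.
      by rewrite !addr_ge0 ?sqr_ge0.
    rewrite mulrDr ler_wpDr//.
      by rewrite addr_ge0// mulr_ge0// mulr_ge0// energy_ge0.
    rewrite lerD//; last by rewrite mulrCA.
    by rewrite mulrCA ler_wpM2l ?(ltW l0)// ler_piMl ?energy_ge0.
  rewrite mulr0 add0r ler_wpDl//.
    by rewrite mulr_ge0 ?invr_ge0 ?(ltW l0)// mulr_ge0// energy_ge0.
  (* Off [S], the common weight is factored out and the energies are compared by [hS]. *)
  rewrite mulrCA [X in _ <= _ + X]mulrCA -mulrDr ler_wpM2l//.
  apply: band_pointwise => //; apply: hS => //.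
  by move=> Sv'; apply: Sv; exact/mem_set.
rewrite RintegralD// RintegralD//; [|exact: L1Z|exact: L1Z].
rewrite RintegralD//; [|exact: L1Z|exact: L1Z].
rewrite !RintegralZl//.
have B := weighted_bessel A0.
apply: lerD; last by apply: lerD; rewrite ler_wpM2l// B.
apply: lerD; first by rewrite ler_wpM2l ?(ltW l0).
by rewrite [leRHS]mulrC ler_wpM2l ?invr_ge0 ?(ltW l0)// B.
Qed.

End BandEstimate.

(** * Twice differentiable functions and the adjoint of the oscillator *)

Section IntegrationByParts.
Context {R : realType}.
Local Notation leb := (@lebesgue_measure R).

Lemma ctsM (f g : R -> R) : continuous f -> continuous g ->
  continuous (fun t => f t * g t).
Proof. by move=> cf cg t; apply: cvgM; [exact: cf|exact: cg]. Qed.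

Lemma ctsD (f g : R -> R) : continuous f -> continuous g ->
  continuous (fun t => f t + g t).
Proof. by move=> cf cg t; apply: cvgD; [exact: cf|exact: cg]. Qed.

Lemma ctsZ (k : R) (f : R -> R) : continuous f -> continuous (fun t => k * f t).
Proof. by move=> cf; apply: ctsM => // t; exact: cvg_cst. Qed.

Lemma ctsB (f g : R -> R) : continuous f -> continuous g ->
  continuous (fun t => f t - g t).
Proof. by move=> cf cg t; apply: cvgB; [exact: cf|exact: cg]. Qed.

Definition C2 (f f1 f2 : R -> R) :=
  [/\ has_deriv f f1, has_deriv f1 f2 & continuous f2].

Lemma C2M f f1 f2 g g1 g2 : C2 f f1 f2 -> C2 g g1 g2 ->
  C2 (fun x => f x * g x) (fun x => f1 x * g x + f x * g1 x)
     (fun x => (f2 x * g x + f1 x * g1 x) + (f1 x * g1 x + f x * g2 x)).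
Proof.
move=> [df df1 cf2] [dg dg1 cg2].
have cf := has_deriv_continuous df; have cf1 := has_deriv_continuous df1.
have cg := has_deriv_continuous dg; have cg1 := has_deriv_continuous dg1.
split.
- exact: has_derivM.
- by apply: has_derivD; exact: has_derivM.
- by apply: ctsD; apply: ctsD; exact: ctsM.
Qed.

Lemma C2_cst (k : R) : C2 (fun=> k) (fun=> 0) (fun=> 0).
Proof. by split; [exact: has_deriv_cst|exact: has_deriv_cst|move=> x; exact: cvg_cst]. Qed.

Lemma C2_affine (a b : R) : C2 (fun x => a * x + b) (fun=> a) (fun=> 0).
Proof.
split; [|exact: has_deriv_cst|by move=> x; exact: cvg_cst].
apply: (has_deriv_eq (has_derivD (has_derivZ a has_deriv_id) (has_deriv_cst b))) => // x.
by rewrite addr0 mulr1.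
Qed.

Lemma C2D f f1 f2 g g1 g2 : C2 f f1 f2 -> C2 g g1 g2 ->
  C2 (fun x => f x + g x) (fun x => f1 x + g1 x) (fun x => f2 x + g2 x).
Proof.
move=> [df df1 cf2] [dg dg1 cg2]; split; [exact: has_derivD|exact: has_derivD|].
exact: ctsD.
Qed.

Lemma C2Z (k : R) f f1 f2 : C2 f f1 f2 ->
  C2 (fun x => k * f x) (fun x => k * f1 x) (fun x => k * f2 x).
Proof.
move=> [df df1 cf2]; split; [exact: has_derivZ|exact: has_derivZ|].
exact: ctsZ.
Qed.

Lemma C2X f f1 f2 (k : nat) : C2 f f1 f2 ->
  exists g1 g2, C2 (fun x => f x ^+ k) g1 g2.
Proof.
move=> Cf; elim: k => [|k [g1 [g2 Cg]]].
  by exists (fun=> 0), (fun=> 0); exact: C2_cst.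
have h := C2M Cf Cg; eexists; eexists.
have -> : (fun x => f x ^+ k.+1) = (fun x => f x * f x ^+ k).
  by apply/funext => x; rewrite exprS.
exact: h.
Qed.

Lemma C2_cosZ (v : R) : C2 (fun t => cos (v * t)) (fun t => - v * sin (v * t))
  (fun t => - v ^+ 2 * cos (v * t)).
Proof.
have hv : has_deriv (fun t => v * t) (fun=> v).
  by apply: (has_deriv_eq (has_derivZ v has_deriv_id)) => // x; rewrite mulr1.
have hc := has_deriv_comp has_deriv_cos hv; have hs := has_deriv_comp has_deriv_sin hv.
split.
- by apply: (has_deriv_eq hc) => // t /=; ring.
- by apply: (has_deriv_eq (has_derivZ (- v) hs)) => // t /=; ring.
- exact: (has_deriv_continuous (has_derivZ (- v ^+ 2) hc)).
Qed.

Lemma C2_sinZ (v : R) : C2 (fun t => sin (v * t)) (fun t => v * cos (v * t))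
  (fun t => - v ^+ 2 * sin (v * t)).
Proof.
have hv : has_deriv (fun t => v * t) (fun=> v).
  by apply: (has_deriv_eq (has_derivZ v has_deriv_id)) => // x; rewrite mulr1.
have hc := has_deriv_comp has_deriv_cos hv; have hs := has_deriv_comp has_deriv_sin hv.
split.
- by apply: (has_deriv_eq hs) => // t /=; ring.
- by apply: (has_deriv_eq (has_derivZ v hc)) => // t /=; ring.
- exact: (has_deriv_continuous (has_derivZ (- v ^+ 2) hs)).
Qed.

Lemma continuous_integrable_itv (a b : R) (f : R -> R) : continuous f ->
  leb.-integrable `[a, b] (EFin \o f).
Proof.
move=> cf; apply: continuous_compact_integrable; first exact: segment_compact.
exact: continuous_subspaceT.
Qed.

Lemma Rintegral_FTC (a b : R) (F f : R -> R) : a <= b -> has_deriv F f ->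
  continuous f -> \int[leb]_(x in `[a, b]) f x = F b - F a.
Proof.
rewrite le_eqVlt => /predU1P[->|ab] dF cf.
  by rewrite set_itv1 Rintegral_set1 subrr.
rewrite /Rintegral (@continuous_FTC2 _ f F)//.
- exact: continuous_subspaceT.
- have cF := has_deriv_continuous dF.
  split; first by move=> x _; exact: (has_deriv_derivable dF).
    by apply: cvg_at_right_filter; exact: cF.
  by apply: cvg_at_left_filter; exact: cF.
- by move=> x _; rewrite (has_derivE dF).
Qed.

(** Two integrations by parts; [p] and [p1] vanish at both ends, so [y] is free there. This allows
    cosines and sines as well as the state for [y]. *)
Lemma adjoint_oscillator (T gam kap : R) (y y1 y2 p p1 p2 : R -> R) : 0 <= T ->
  C2 y y1 y2 -> C2 p p1 p2 ->
  p 0 = 0 -> p1 0 = 0 -> p T = 0 -> p1 T = 0 ->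
  \int[leb]_(t in `[0, T]) (y t * (p2 t - 2 * gam * p1 t + kap * p t)) =
  \int[leb]_(t in `[0, T]) ((y2 t + 2 * gam * y1 t + kap * y t) * p t).
Proof.
move=> T0 [dy dy1 cy2] [dp dp1 cp2] p00 p10 pT p1T.
have cy := has_deriv_continuous dy; have cy1 := has_deriv_continuous dy1.
have cp := has_deriv_continuous dp; have cp1 := has_deriv_continuous dp1.
(* The difference of the two integrands, which is the derivative of y * p' - y' * p - 2 * gam * y *
   p. *)
pose f t := y t * p2 t - y2 t * p t - 2 * gam * (y1 t * p t + y t * p1 t).
have dF : has_deriv (fun t => y t * p1 t - y1 t * p t - 2 * gam * (y t * p t)) f.
  apply: (has_deriv_eq (has_derivB (has_derivB (has_derivM dy dp1)
    (has_derivM dy1 dp)) (has_derivZ (2 * gam) (has_derivM dy dp)))) => // t.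
  by rewrite /f; ring.
have cf : continuous f.
  rewrite /f; exact: (ctsB (ctsB (ctsM cy cp2) (ctsM cy2 cp))
    (ctsZ (ctsD (ctsM cy1 cp) (ctsM cy cp1)))).
have ck : continuous (fun t => (y2 t + 2 * gam * y1 t + kap * y t) * p t).
  exact: (ctsM (ctsD (ctsD cy2 (ctsZ cy1)) (ctsZ cy)) cp).
rewrite (_ : \int[leb]_(t in _) _ =
    \int[leb]_(t in `[0, T]) ((y2 t + 2 * gam * y1 t + kap * y t) * p t + f t)); last first.
  by apply: eq_Rintegral => t _; rewrite /f; ring.
rewrite RintegralD//; [|exact: continuous_integrable_itv|exact: continuous_integrable_itv].
by rewrite (Rintegral_FTC T0 dF cf) p00 p10 pT p1T; ring.
Qed.

End IntegrationByParts.

(** * The adjoint operator on the frequency side *)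

Section Duality.
Context {R : realType}.
Local Notation leb := (@lebesgue_measure R).
Local Notation L1 f := (leb.-integrable setT (EFin \o f)).

Lemma L1_patch (D : set (measurableTypeR R)) (f : R -> R) : measurable D ->
  leb.-integrable D (EFin \o f) -> L1 (f \_ D).
Proof. by move=> mD iD; have := (integrable_mkcond _ mD).1 iD; rewrite restrict_EFin. Qed.

Lemma L1_patch_itv (T : R) (f : R -> R) : continuous f -> L1 (f \_ `[0, T]).
Proof. by move=> cf; apply: L1_patch => //; exact: continuous_integrable_itv. Qed.

Lemma patch_sqr (D : set R) (f : R -> R) x : (f \_ D) x ^+ 2 = ((fun x => f x ^+ 2) \_ D) x.
Proof. by rewrite !patchE; case: ifP => // _; rewrite expr0n. Qed.

Lemma L1_patch_sqr (T : R) (f : R -> R) : continuous f ->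
  L1 (fun x => (f \_ `[0, T]) x ^+ 2).
Proof.
move=> cf; rewrite (_ : (fun x => _) = (fun x => f x ^+ 2) \_ `[0, T]).
  by apply: L1_patch_itv; exact: ctsM.
by apply/funext => x; rewrite patch_sqr.
Qed.

Lemma cosT_patch (D : set R) (f : R -> R) v :
  cosT (f \_ D) v = \int[leb]_(t in D) (f t * cos (v * t)).
Proof.
rewrite Rintegral_mkcond; apply: eq_Rintegral => t _.
by rewrite !patchE; case: ifP => // _; rewrite mul0r.
Qed.

Lemma sinT_patch (D : set R) (f : R -> R) v :
  sinT (f \_ D) v = \int[leb]_(t in D) (f t * sin (v * t)).
Proof.
rewrite Rintegral_mkcond; apply: eq_Rintegral => t _.
by rewrite !patchE; case: ifP => // _; rewrite mul0r.
Qed.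

(** The formal adjoint of y'' + 2 * gam * y' + kap * y; the first-order term changes sign. *)
Definition adjoint_op (gam kap : R) (p p1 p2 : R -> R) (t : R) : R :=
  p2 t - 2 * gam * p1 t + kap * p t.

(** The squared modulus of the symbol kap - v^2 + 2 i gam v, so the square of [dsymb] for the right
    [kap]. *)
Definition symb2 (gam kap v : R) : R := (kap - v ^+ 2) ^+ 2 + (2 * gam * v) ^+ 2.

(** Moving the operator onto cos (v t) and sin (v t) shows that it acts on the pair ([cosT], [sinT])
    as a rotation times a scaling, which multiplies the sum of squares by [symb2]. *)
Lemma energy_adjoint (T gam kap : R) (p p1 p2 : R -> R) v : 0 <= T ->
  C2 p p1 p2 -> p 0 = 0 -> p1 0 = 0 -> p T = 0 -> p1 T = 0 ->
  energy (adjoint_op gam kap p p1 p2 \_ `[0, T]) v =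
  symb2 gam kap v * energy (p \_ `[0, T]) v.
Proof.
move=> T0 Cp p0 p10 pT p1T; have [dp _ _] := Cp; have cp := has_deriv_continuous dp.
have cc : continuous (fun t => cos (v * t)).
  by have [d _ _] := C2_cosZ v; exact: has_deriv_continuous d.
have cs : continuous (fun t => sin (v * t)).
  by have [d _ _] := C2_sinZ v; exact: has_deriv_continuous d.
have Ic := continuous_integrable_itv 0 T (ctsM cp cc).
have Is := continuous_integrable_itv 0 T (ctsM cp cs).
have Ick k := continuous_integrable_itv 0 T (ctsZ (k:=k) (ctsM cp cc)).
have Isk k := continuous_integrable_itv 0 T (ctsZ (k:=k) (ctsM cp cs)).
have ec : cosT (adjoint_op gam kap p p1 p2 \_ `[0, T]) v =
    (kap - v ^+ 2) * cosT (p \_ `[0, T]) v + - (2 * gam * v) * sinT (p \_ `[0, T]) v.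
  rewrite !cosT_patch !sinT_patch -!RintegralZl// -RintegralD//.
  transitivity (\int[leb]_(t in `[0, T]) (cos (v * t) * adjoint_op gam kap p p1 p2 t)).
    by apply: eq_Rintegral => t _; rewrite mulrC.
  rewrite (adjoint_oscillator gam kap T0 (C2_cosZ v) Cp)//.
  by apply: eq_Rintegral => t _; ring.
have es : sinT (adjoint_op gam kap p p1 p2 \_ `[0, T]) v =
    (kap - v ^+ 2) * sinT (p \_ `[0, T]) v + (2 * gam * v) * cosT (p \_ `[0, T]) v.
  rewrite !cosT_patch !sinT_patch -!RintegralZl// -RintegralD//.
  transitivity (\int[leb]_(t in `[0, T]) (sin (v * t) * adjoint_op gam kap p p1 p2 t)).
    by apply: eq_Rintegral => t _; rewrite mulrC.
  rewrite (adjoint_oscillator gam kap T0 (C2_sinZ v) Cp)//.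
  by apply: eq_Rintegral => t _; ring.
by rewrite /energy ec es /symb2; ring.
Qed.

Lemma patch_bounded (T : R) (f : R -> R) : 0 <= T -> continuous f ->
  exists M, forall x, `|(f \_ `[0, T]) x| <= M.
Proof.
move=> T0 cf; have cf' : {within `[0, T], continuous f} by exact: continuous_subspaceT.
have [c _ hc] := EVT_max T0 cf'; have [d _ hd] := EVT_min T0 cf'.
exists (`|f c| + `|f d|) => x; rewrite patchE; case: ifPn => [/set_mem/= xT|_].
  have h1 := hc _ xT; have h2 := hd _ xT; rewrite ler_norml; apply/andP; split.
    rewrite lerNl (le_trans (_ : _ <= - f d)) ?lerN2//.
    by rewrite (le_trans (ler_norm _))// normrN lerDr.
  by rewrite (le_trans h1)// (le_trans (ler_norm _))// lerDl.
by rewrite normr0 addr_ge0.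
Qed.

Lemma ae_neq (a : R) : {ae leb, forall x, x <> a}.
Proof.
exists [set a]; split => //; first exact: lebesgue_measure_set1.
by move=> x /= /contrapT.
Qed.

(** Jumps can occur only at 0 and T. *)
Lemma patch_ae_continuous (T : R) (f : R -> R) : continuous f ->
  {ae leb, forall s, {for s, continuous (f \_ `[0, T])}}.
Proof.
move=> cf; have h := ae_lebI (ae_neq 0) (ae_neq T).
apply: ae_lebS h => s [s0 sT].
have [inT|notT] := boolP (s \in `]0, T[).
  have nh : \forall x \near s, f x = (f \_ `[0, T]) x.
    near=> x; rewrite patchE ifT//; apply/mem_set => /=; rewrite in_itv/=.
    have : x \in `]0, T[ by near: x; exact: (near_in_itvoo inT).
    by rewrite in_itv/= => /andP[/ltW-> /ltW->].
  have h1 : (f \_ `[0, T]) @ s --> f s by exact: (cvg_trans (near_eq_cvg nh) (cf s)).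
  by rewrite (nbhs_singleton nh) in h1.
have sout : s < 0 \/ T < s.
  move: notT; rewrite in_itv/= negb_and -!leNgt => /orP[h1|h1]; [left|right].
    by rewrite lt_neqAle h1 andbT; exact/eqP.
  by rewrite lt_neqAle h1 andbT eq_sym; exact/eqP.
have nh : \forall x \near s, 0 = (f \_ `[0, T]) x.
  have out x : x < 0 \/ T < x -> 0 = (f \_ `[0, T]) x.
    move=> xo; rewrite patchE ifF//; apply/negbTE; rewrite notin_setE/= in_itv/=.
    move=> /andP[x0 xT]; case: xo => xo.
      by have := lt_le_trans xo x0; rewrite ltxx.
    by have := le_lt_trans xT xo; rewrite ltxx.
  case: sout => h1.
    by near=> x; apply: out; left; near: x; exact: lt_nbhsl.
  by near=> x; apply: out; right; near: x; exact: lt_nbhsr.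
have h1 : (f \_ `[0, T]) @ s --> (f \_ `[0, T]) s.
  rewrite -(nbhs_singleton nh).
  by apply: (cvg_trans (near_eq_cvg nh)); exact: cvg_cst.
exact: h1.
Unshelve. all: by end_near. Qed.

End Duality.

(** * The duality estimate for a band-limited function *)

Section BandDuality.
Context {R : realType}.
Local Notation leb := (@lebesgue_measure R).
Local Notation mR := (measurableTypeR R).
Local Notation L1 f := (leb.-integrable setT (EFin \o f)).
Variable g : R -> R.
Hypotheses (mg : measurable_fun setT g) (g2 : L1 (fun x => g x ^+ 2)).

(** A square-integrable [g] need not be integrable on the line; its truncations are, and they are
    the ones in the definition of the Plancherel transform. *)
Definition trunc (N : nat) : R -> R := g \_ `[- N%:R, N%:R].

Lemma measurable_trunc N : measurable_fun setT (trunc N).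
Proof.
by apply: ((measurable_restrictT _ _).1 (measurable_funTS mg)).
Qed.

Lemma L1_trunc_sqr N : L1 (fun x => trunc N x ^+ 2).
Proof.
apply: (le_integrable measurableT _ _ g2).
  by apply/measurable_EFinP; apply: measurable_funX; exact: measurable_trunc.
move=> x _ /=; rewrite lee_fin /trunc patchE; case: ifP => // _.
by rewrite expr0n normr0.
Qed.

Lemma integral_trunc_sqr N :
  \int[leb]_x trunc N x ^+ 2 <= \int[leb]_x g x ^+ 2.
Proof.
apply: le_Rintegral => //; first exact: L1_trunc_sqr.
move=> x _; rewrite /trunc patchE; case: ifP => // _.
by rewrite expr0n/= sqr_ge0.
Qed.

(** On the bounded interval, |g| <= 1 + g^2. *)
Lemma L1_trunc N : L1 (trunc N).
Proof.
have i1 : L1 ((fun _ : R => (1 : R)) \_ `[- N%:R, N%:R]).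
  apply: L1_patch => //.
  by apply: continuous_integrable_itv => x; exact: cvg_cst.
apply: (le_integrable measurableT _ _ (L1D i1 (L1_trunc_sqr N))).
  by apply/measurable_EFinP; exact: measurable_trunc.
move=> x _ /=; rewrite lee_fin /trunc !patchE; case: ifP => _; last first.
  by rewrite normr0.
rewrite [leRHS]ger0_norm ?addr_ge0 ?sqr_ge0// -[g x ^+ 2]real_normK ?num_real//.
have := sqr_ge0 (`|g x| - 1); have := sqr_ge0 `|g x|; lra.
Qed.

Variables (T gam kap D : R) (p p1 p2 : R -> R).
Hypotheses (T0 : 0 < T) (Cp : C2 p p1 p2).
Hypotheses (p00 : p 0 = 0) (p10 : p1 0 = 0) (pT : p T = 0) (p1T : p1 T = 0).

(** When D is the supremum of the symbol over the band, these frequencies lie outside the band. *)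
Let S : set R := [set v | 0 <= v /\ D ^+ 2 < symb2 gam kap v].

Lemma measurable_symb2 : measurable_fun setT (symb2 gam kap).
Proof.
apply: measurable_funD; apply: measurable_funX.
  by apply: measurable_funB => //; exact: measurable_funX.
exact: measurable_funM.
Qed.

Lemma measurable_out_of_band : measurable S.
Proof.
have -> : S = `[0, +oo[ `&` (symb2 gam kap @^-1` `]D ^+ 2, +oo[).
  by apply/seteqP; split => v /=; rewrite !in_itv/= !andbT.
apply: measurableI => //; rewrite -[X in measurable X]setTI.
by apply: measurable_symb2.
Qed.

Hypothesis hS : (fun N => \int[leb]_(v in S) (energy (trunc N) v)%:E)%E @ \oo --> 0%E.

Let q := adjoint_op gam kap p p1 p2.

(** The weighted estimate is applied to a truncation of [g] paired with the adjoint of [p]. By [hS]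
    the energy of the truncation on [S] can be made as small as desired, so the terms coming from
    [S] cost at most an arbitrary e. *)
Lemma band_duality (s : R) : 0 < s ->
  \int[leb]_(t in `[0, T]) (g t * q t) <=
  s / 2 * \int[leb]_x g x ^+ 2 +
  D ^+ 2 / (2 * s) * \int[leb]_(t in `[0, T]) p t ^+ 2.
Proof.
move=> s0; have [dp dp1 cp2] := Cp.
have cp := has_deriv_continuous dp; have cp1 := has_deriv_continuous dp1.
have cq : continuous q by exact: (ctsD (ctsB cp2 (ctsZ cp1)) (ctsZ cp)).
pose phi := p \_ `[0, T]; pose psi := q \_ `[0, T].
have phi1 : L1 phi by exact: L1_patch_itv.
have phi2 : L1 (fun x => phi x ^+ 2) by exact: L1_patch_sqr.
have psi1 : L1 psi by exact: L1_patch_itv.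
have psi2 : L1 (fun x => psi x ^+ 2) by exact: L1_patch_sqr.
have pi0 : (0 : R) < pi by exact: pi_gt0.
(* Both frequency inequalities carry the factor pi, so it is inserted on both sides. *)
rewrite -(ler_pM2l pi0).
set B := leRHS; apply/ler_addgt0Pr => e e0.
set P := pi * \int[leb]_x psi x ^+ 2.
have P0 : 0 <= P.
  by rewrite mulr_ge0 ?(ltW pi0)// Rintegral_ge0// => x _; exact: sqr_ge0.
(* This l gives P / l <= e / 2, and [dl] below gives l * dl = e / 2. The summand 1 keeps l positive
   when P = 0. *)
pose l := 2 * P / e + 1.
have P2 : 0 <= 2 * P / e.
  by apply: divr_ge0; [apply: mulr_ge0|exact: ltW].
have l0 : 0 < l by rewrite ltr_wpDl.
have Pl : P / l <= e / 2.
  rewrite ler_pdivrMr// /l mulrDr mulr1.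
  have -> : e / 2 * (2 * P / e) = P by field; rewrite gt_eqF.
  by rewrite lerDl divr_ge0// ltW.
pose dl := e / (2 * l).
have dl0 : 0 < dl by rewrite divr_gt0// mulr_gt0.
have [N [TN hN]] : exists N : nat, T <= N%:R /\
    (\int[leb]_(v in S) (energy (trunc N) v)%:E <= dl%:E)%E.
  have h1 : \forall N \near \oo,
      (\int[leb]_(v in S) (energy (trunc N) v)%:E <= dl%:E)%E.
    have /fine_cvgP[hf hc] := hS; have hl := cvgr_lt _ hc _ dl0.
    near=> N; have fN : (\int[leb]_(v in S) (energy (trunc N) v)%:E \is a fin_num)%E.
      by near: N; exact: hf.
    rewrite -(fineK fN) lee_fin ltW//; near: N; exact: hl.
  have h2 : \forall N \near \oo, T <= N%:R.
    exact: nbhs_infty_ger.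
  have [N [? ?]] := @filter_ex _ _ _ _ (filterI h2 h1).
  by exists N.
have f1 := L1_trunc N; have f2 := L1_trunc_sqr N.
have [M psiM] := patch_bounded (ltW T0) cq.
have cv := weighted_parseval_cvg f1 psi1 psiM (patch_ae_continuous T cq).
(* As T <= N, the truncation does not touch [g] on [0, T], outside which [psi] vanishes. *)
have -> : \int[leb]_(t in `[0, T]) (g t * q t) = \int[leb]_t (trunc N t * psi t).
  rewrite Rintegral_mkcond; apply: eq_Rintegral => t _.
  rewrite /psi /trunc !patchE; case: ifP => [/set_mem/=|_]; last by rewrite mulr0.
  rewrite in_itv/= => /andP[t0 tT]; rewrite ifT//; apply/mem_set => /=.
  by rewrite in_itv/= (le_trans tT TN) andbT (le_trans _ t0)// oppr_le0.
(* The left side is the limit of weighted frequency integrals, and the bound is uniform in the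
   weight. *)
rewrite -(cvg_lim _ cv)//; apply: limr_le; first by apply/cvg_ex; eexists; exact: cv.
apply: nearW => k.
have A0 : (0 : R) < k.+1%:R by [].
have := weighted_band_estimate A0 l0 s0 measurable_out_of_band f1 f2 phi1 phi2 psi1 psi2.
move=> /(_ D dl) h; apply: (le_trans (h _ hN)) => {h}.
  move=> v v0 nSv; rewrite /psi energy_adjoint ?(ltW T0)// ler_wpM2r ?energy_ge0//.
  by rewrite leNgt; apply/negP => ?; apply: nSv.
rewrite [leRHS]addrC; apply: lerD.
  rewrite -/P [e in leRHS]splitr; apply: lerD => //.
  by rewrite /dl le_eqVlt; apply/orP; left; apply/eqP; field; rewrite gt_eqF.
rewrite /B mulrDr; apply: lerD.
  rewrite mulrCA ler_wpM2l ?(ltW pi0)// ler_wpM2l ?divr_ge0 ?(ltW s0)//.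
  exact: integral_trunc_sqr.
rewrite mulrCA ler_wpM2l ?(ltW pi0)// ler_wpM2l//.
  by rewrite divr_ge0 ?sqr_ge0// mulr_ge0// ltW.
rewrite [leRHS]Rintegral_mkcond le_eqVlt; apply/orP; left; apply/eqP.
by apply: eq_Rintegral => t _; rewrite patch_sqr.
Unshelve. all: by end_near. Qed.

End BandDuality.

(** * Cutoffs and the bound for a smooth control *)

Section Cutoff.
Context {R : realType}.
Local Notation leb := (@lebesgue_measure R).
Local Notation L1 f := (leb.-integrable setT (EFin \o f)).

(** The polynomial 1 - (1 - 2 t / T)^(2 k): zero at 0 and T, between 0 and 1 on [0, T], tending to 1
    inside. It is written so that the closure rules for [C2] apply directly. *)
Definition cutoff (T : R) (k : nat) (t : R) : R :=
  1 + -1 * ((- (2 / T) * t + 1) * (- (2 / T) * t + 1)) ^+ k.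

Lemma C2_cutoff T k : exists v1 v2, C2 (cutoff T k) v1 v2.
Proof.
have r := C2_affine (- (2 / T)) 1.
have [g1 [g2 Cg]] := C2X k (C2M r r).
by eexists; eexists; exact: (C2D (C2_cst 1) (C2Z (-1) Cg)).
Qed.

Lemma cutoff0 T k : cutoff T k 0 = 0.
Proof. by rewrite /cutoff mulr0 add0r mulr1 expr1n mulr1 subrr. Qed.

Lemma cutoffT T k : 0 < T -> cutoff T k T = 0.
Proof.
move=> T0; have e : - (2 / T) * T + 1 = -1 by field; rewrite gt_eqF.
by rewrite /cutoff e mulrNN mulr1 expr1n mulr1 subrr.
Qed.

Lemma cutoff_base (T t : R) : 0 < T -> 0 <= t <= T ->
  0 <= (- (2 / T) * t + 1) * (- (2 / T) * t + 1) <= 1.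
Proof.
move=> T0 /andP[t0 tT]; rewrite -expr2 sqr_ge0/=.
have -> : (- (2 / T) * t + 1) ^+ 2 = 1 - 4 * (t * (T - t)) / T ^+ 2.
  by field; rewrite gt_eqF.
by rewrite gerBl divr_ge0 ?sqr_ge0// mulr_ge0// mulr_ge0// subr_ge0.
Qed.

Lemma cutoff_itv (T t : R) k : 0 < T -> 0 <= t <= T -> 0 <= cutoff T k t <= 1.
Proof.
move=> T0 tT; have /andP[b0 b1] := cutoff_base T0 tT.
rewrite /cutoff mulN1r subr_ge0 gerBl exprn_ge0// andbT.
exact: exprn_ile1.
Qed.

Lemma cutoff_cvg (T t : R) : 0 < T -> 0 < t < T ->
  (fun k => cutoff T k t) @ \oo --> (1 : R).
Proof.
move=> T0 /andP[t0 tT].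
have b1 : `|(- (2 / T) * t + 1) * (- (2 / T) * t + 1)| < 1.
  rewrite ger0_norm -expr2 ?sqr_ge0//.
  have -> : (- (2 / T) * t + 1) ^+ 2 = 1 - 4 * (t * (T - t)) / T ^+ 2.
    by field; rewrite gt_eqF.
  by rewrite gtrBl divr_gt0 ?exprn_gt0// mulr_gt0// mulr_gt0// subr_gt0.
have h : (fun k => cutoff T k t) @ \oo --> 1 + -1 * (0 : R).
  apply: cvgD; first exact: cvg_cst.
  by apply: cvgM; [exact: cvg_cst|exact: cvg_expr].
by rewrite mulr0 addr0 in h.
Qed.

Lemma half_absorb (x b d : R) : x <= d / 2 * b + 2^-1 * x -> x <= d * b.
Proof. by move=> h; lra. Qed.

Section bound.
Variables (g : R -> R).
Hypotheses (mg : measurable_fun setT g) (g2 : L1 (fun x => g x ^+ 2)).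
Variables (T gam kap D : R) (T0 : 0 < T).
Hypothesis hS : (fun N => \int[leb]_(v in
   [set v : R | 0 <= v /\ D ^+ 2 < symb2 gam kap v]%R) (energy (trunc g N) v)%:E)%E
     @ \oo --> 0%E.
Variables (h h1 h2 u1 u2 : R -> R).
Hypotheses (Ch : C2 h h1 h2).
Let u t := h2 t + 2 * gam * h1 t + kap * h t.
Hypotheses (Cu : C2 u u1 u2).
Hypothesis gh : {ae leb, forall t, t \in `]0, T[ -> g t = h t}.

(** Test against p = v^2 u, with X the left side. Then X = <u, p> = <g, q> and the square norm of
    [p] is at most X, so [band_duality] bounds X by itself with a coefficient that s can make
    1/2. *)
Lemma cutoff_bound k :
  \int[leb]_(t in `[0, T]) (cutoff T k t ^+ 2 * u t ^+ 2) <=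
  D ^+ 2 * \int[leb]_x g x ^+ 2.
Proof.
have [v1 [v2 Cv]] := C2_cutoff T k; set v := cutoff T k in Cv *.
have v0 : v 0 = 0 by exact: cutoff0.
have vT : v T = 0 by exact: cutoffT.
(* With two factors v in [p], every term of its derivative still contains one, so both vanish at 0
   and T. *)
have Cw := C2M Cv Cu; have Cp := C2M Cv Cw.
set p := fun x => v x * (v x * u x) in Cp.
set p1 := (X in C2 _ X _) in Cp; set p2 := (X in C2 _ _ X) in Cp.
have p00 : p 0 = 0 by rewrite /p v0 mul0r.
have pT : p T = 0 by rewrite /p vT mul0r.
have p10 : p1 0 = 0 by rewrite /p1 v0 !mul0r mulr0 addr0.
have p1T : p1 T = 0 by rewrite /p1 vT !mul0r mulr0 addr0.
have [dh dh1 ch2] := Ch; have ch := has_deriv_continuous dh.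
have [dp dp1 cp2] := Cp; have cp := has_deriv_continuous dp.
have cp1 := has_deriv_continuous dp1.
have [du _ _] := Cu; have cu := has_deriv_continuous du.
set q := adjoint_op gam kap p p1 p2.
have cq : continuous q by exact: (ctsD (ctsB cp2 (ctsZ cp1)) (ctsZ cp)).
set X := \int[leb]_(t in _) _; set B := \int[leb]_x _.
have B0 : 0 <= B by apply: Rintegral_ge0 => x _; exact: sqr_ge0.
have XE : X = \int[leb]_(t in `[0, T]) (g t * q t).
  transitivity (\int[leb]_(t in `[0, T]) (u t * p t)).
    by apply: eq_Rintegral => t _; rewrite /p; ring.
  rewrite /u -(adjoint_oscillator gam kap (ltW T0) Ch Cp)//.
  (* [h] is replaced by [g], equal almost everywhere on the open interval; the endpoints are
     null. *)
  congr fine; apply: ae_eq_integral => //.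
  - apply/measurable_EFinP/measurable_funTS.
    by apply: continuous_measurable_fun; exact: ctsM.
  - apply/measurable_EFinP/measurable_funTS; apply: measurable_funM => //.
    exact: continuous_measurable_fun.
  - apply: ae_lebS (ae_lebI (ae_lebI (ae_neq 0) (ae_neq T)) gh).
    move=> t [[t0 tT] ght] /=; rewrite in_itv/= => /andP[t0' tT'].
    rewrite ght// in_itv/= !lt_neqAle t0' tT' !andbT eq_sym.
    by apply/andP; split; exact/eqP.
(* Here p^2 = v^4 u^2 <= v^2 u^2, since 0 <= v <= 1. *)
have p2X : \int[leb]_(t in `[0, T]) p t ^+ 2 <= X.
  have cv := has_deriv_continuous (let: And3 d _ _ := Cv in d).
  apply: le_Rintegral => //.
  - by apply: continuous_integrable_itv; exact: (ctsM cp cp).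
  - apply: continuous_integrable_itv.
    exact: (ctsM (ctsM cv cv) (ctsM cu cu)).
  - move=> t /=; rewrite in_itv/= => tT.
    have /andP[vt0 vt1] := cutoff_itv k T0 tT; rewrite -/v in vt0 vt1.
    rewrite /p mulrA -expr2 exprMn ler_wpM2r ?sqr_ge0//.
    by rewrite ler_piMr ?sqr_ge0// expr_le1.
have key s : 0 < s -> X <= s / 2 * B + D ^+ 2 / (2 * s) * X.
  move=> s0; rewrite {1}XE.
  apply: (le_trans (band_duality mg g2 T0 Cp p00 p10 pT p1T hS s0)).
  by rewrite lerD2l ler_wpM2l// divr_ge0 ?sqr_ge0// mulr_ge0// ltW.
(* For D = 0 the term in X disappears and s = e / (B + 1) leaves at most e; B itself may be 0. *)
have [D00|D00] := eqVneq D 0.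
  rewrite D00 expr0n/= mul0r; apply/ler_addgt0Pr => e e0.
  have e1 : 0 < e / (B + 1) by rewrite divr_gt0// ltr_wpDl.
  have := key _ e1; rewrite D00 expr0n/= !mul0r addr0 add0r => /le_trans; apply.
  rewrite mulrAC ler_pdivrMr// mulrAC ler_pdivrMr ?ltr_wpDl// -mulrA.
  by rewrite ler_wpM2l ?(ltW e0)//; lra.
(* With s = D^2 the coefficient of X on the right is 1/2, and X can be absorbed. *)
have D2 : 0 < D ^+ 2 by rewrite exprn_even_gt0.
have := key _ D2.
have -> : D ^+ 2 / (2 * D ^+ 2) = 2^-1 by field.
exact: half_absorb.
Qed.

(** Dominated convergence as the cutoffs tend to 1 on the open interval, with u^2 as the dominating
    function. *)
Lemma smooth_bound :
  \int[leb]_(t in `[0, T]) u t ^+ 2 <= D ^+ 2 * \int[leb]_x g x ^+ 2.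
Proof.
have [du _ _] := Cu; have cu := has_deriv_continuous du.
have cu2 : continuous (fun t => u t ^+ 2) by exact: (ctsM cu cu).
have ccut k : continuous (fun t => cutoff T k t ^+ 2 * u t ^+ 2).
  have [v1 [v2 [dv _ _]]] := C2_cutoff T k; have cv := has_deriv_continuous dv.
  exact: (ctsM (ctsM cv cv) cu2).
have [|||||_ _] := @dominated_convergence _ _ _ leb `[0, T] (measurable_itv _)
  (fun k t => (cutoff T k t ^+ 2 * u t ^+ 2)%:E) (fun t => (u t ^+ 2)%:E)
  (fun t => (u t ^+ 2)%:E).
- move=> k; apply/measurable_EFinP/measurable_funTS.
  exact: continuous_measurable_fun.
- apply/measurable_EFinP/measurable_funTS.
  exact: continuous_measurable_fun.
- apply: ae_lebS (ae_lebI (ae_neq 0) (ae_neq T)) => t [t0 tT] /=.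
  rewrite in_itv/= => /andP[t0' tT'].
  apply/fine_cvgP; split; first exact: nearW.
  have tI : 0 < t < T.
    by rewrite !lt_neqAle t0' tT' !andbT eq_sym; apply/andP; split; exact/eqP.
  have c1 := cutoff_cvg T0 tI.
  have c2 : (fun k => cutoff T k t ^+ 2 * u t ^+ 2) @ \oo --> (1 * 1) * u t ^+ 2.
    by apply: cvgM; [exact: (cvgM c1 c1)|exact: cvg_cst].
  by rewrite !mul1r in c2.
- exact: continuous_integrable_itv.
- apply: aeW => t k /=; rewrite in_itv/= => tI.
  have /andP[v0 v1] := cutoff_itv k T0 tI.
  have n0 : 0 <= cutoff T k t ^+ 2 * u t ^+ 2 by rewrite mulr_ge0 ?sqr_ge0.
  rewrite lee_fin (ger0_norm n0). apply: ler_piMl; first exact: sqr_ge0.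
  by rewrite expr_le1.
- have -> : (\int[leb]_(t in `[0%R, T]) (u t ^+ 2)%:E)%E =
      (\int[leb]_(t in `[0, T]) u t ^+ 2)%:E.
    rewrite /Rintegral fineK//; apply: integrable_fin_num => //.
    exact: continuous_integrable_itv.
  move/fine_cvg => c; rewrite -(cvg_lim _ c)//; apply: limr_le.
    by apply/cvg_ex; eexists; exact: c.
  by apply: nearW => k; exact: cutoff_bound.
Qed.

End bound.
End Cutoff.

(** * Square-integrable functions, essential support and energy outside the band *)

Section BandExtension.
Context {R : realType}.
Local Notation leb := (@lebesgue_measure R).
Local Notation mR := (measurableTypeR R).
Local Notation L1 f := (leb.-integrable setT (EFin \o f)).

Lemma L2T_measurable (f : R -> R) : L2 setT f -> measurable_fun setT f.
Proof. by rewrite /L2 patch_setT inE => /andP[/[!inE]]. Qed.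

Lemma L2T_sqr (f : R -> R) : L2 setT f -> L1 (fun x => f x ^+ 2).
Proof. by rewrite /L2 patch_setT; exact: Lfun2_integrable_sqr. Qed.

Lemma L2_of_sqr (D : set R) (f : R -> R) : measurable_fun setT (f \_ D) ->
  L1 (fun x => (f \_ D) x ^+ 2) -> L2 D f.
Proof.
move=> mf /integrableP[_ f2]; rewrite /L2 inE; apply/andP; split; rewrite inE//=.
rewrite /finite_norm; apply: (@lty_poweRy _ _ 2) => //.
rewrite powR_Lnorm//; apply: le_lt_trans f2; rewrite le_eqVlt; apply/orP; left.
apply/eqP; apply: eq_integral => x _ /=.
by rewrite normrX powR_mulrn.
Qed.

Lemma L2norm_sqr (f : R -> R) : L2 setT f ->
  L2norm f ^+ 2 = \int[leb]_x f x ^+ 2.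
Proof.
move=> f2; have i2 := L2T_sqr f2.
have fin : ('N[leb]_2%:E[EFin \o f] \is a fin_num)%E.
  move: f2; rewrite /L2 patch_setT inE => /andP[_]; rewrite inE /finite_norm => ?.
  by rewrite ge0_fin_numE// Lnorm_ge0.
apply: EFin_inj; rewrite EFin_Rintegral//.
have h := powR_Lnorm leb (EFin \o f) (r := 2).
transitivity (('N[leb]_2%:E[EFin \o f]) `^ 2)%E.
  by rewrite -[in RHS](fineK fin) poweR_EFin -powR_mulrn ?fine_ge0 ?Lnorm_ge0.
rewrite h//; apply: eq_integral => x _ /=.
by rewrite powR_mulrn// real_normK ?num_real.
Qed.

Lemma L2norm_ge0 (f : R -> R) : 0 <= L2norm f.
Proof. by rewrite fine_ge0// Lnorm_ge0. Qed.

(** The complement of the support is a union of open sets on each of which [G] vanishes almost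
    everywhere. Intervals with rational endpoints reduce it to a countable union. *)
Lemma ae_ess_support (G : R -> R[i]) :
  {ae leb, forall v, ~ ess_support G v -> G v = 0}.
Proof.
pose J (k : nat) : set R :=
  if @unpickle (rat * rat)%type k is Some pq then `]ratr pq.1, ratr pq.2[%classic else set0.
(* [J k] enumerates the rational intervals through [unpickle]; [N k] keeps the nonzero set of [G] in
   [J k] only if it is negligible. *)
pose N (k : nat) : set R :=
  if `[< leb.-negligible [set v | J k v /\ G v != 0] >]
  then [set v | J k v /\ G v != 0] else set0.
apply: (@negligibleS _ _ _ leb (\bigcup_k N k)).
  move=> v /= /not_implyP[nv Gv].
  have [U [nU GU]] : exists U, nbhs v U /\ {ae leb, forall x, U x -> G x = 0}.
    apply: contrapT => h; apply: nv => U nU GU; apply: h; by exists U.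
  have [e /= e0 eU] := nU.
  have lt1 : v - e < v by rewrite ltrBlDr ltrDl.
  have lt2 : v < v + e by rewrite ltrDl.
  have [p] := rat_in_itvoo lt1; rewrite in_itv/= => /andP[p1 p2].
  have [r] := rat_in_itvoo lt2; rewrite in_itv/= => /andP[r1 r2].
  have Jv x : J (pickle (p, r)) x = (ratr p < x < ratr r) :> Prop.
    by rewrite /J pickleK /= in_itv.
  exists (pickle (p, r)) => //; rewrite /N ifT.
    by split; [rewrite Jv p2 r1|exact/eqP].
  apply/asboolP; apply: negligibleS GU => x [+ Gx] /=; rewrite Jv => /andP[x1 x2].
  move=> h; apply/negP: Gx; rewrite negbK; apply/eqP/h/eU => /=.
  by rewrite ltr_distlC (lt_trans p1)//= (lt_trans x2).
apply: negligible_bigcup => k; rewrite /N; case: ifP => [/asboolP//|_].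
exact: negligible_set0.
Qed.

Lemma fourier_truncE (g : R -> R) (N : nat) v :
  fourier_trunc g N%:R v = ((cosT (trunc g N) v) +i* (- sinT (trunc g N) v))%C.
Proof. by rewrite /fourier_trunc /trunc cosT_patch sinT_patch. Qed.

Lemma normc_sqr (a b : R) (z : R[i]) :
  Normc.normc ((a +i* b)%C - z) ^+ 2 =
  (a - complex.Re z) ^+ 2 + (b - complex.Im z) ^+ 2.
Proof. by case: z => c d /=; rewrite sqr_sqrtr// addr_ge0 ?sqr_ge0. Qed.

(** On [S] the transform [G] is 0 almost everywhere, so there the energy of a truncation is its
    squared distance to [G], whose integral over the whole line tends to 0. *)
Lemma energy_out_cvg (g : R -> R) (G : R -> R[i]) (S : set R) :
  measurable S -> measurable_fun setT g -> L1 (fun x => g x ^+ 2) ->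
  is_fourier g G -> (forall v, S v -> ~ ess_support G v) ->
  (fun N => \int[leb]_(v in S) (energy (trunc g N) v)%:E)%E @ \oo --> 0%E.
Proof.
move=> mS mg g2 [/L2T_measurable mRe /L2T_measurable mIm hG] SG.
apply: (squeeze_cvge _ (@cvg_cst _ 0%E _ _ _) hG); apply: nearW => N.
have f1 := L1_trunc mg g2 N.
have mc := measurable_cosT f1; have ms := measurable_sinT f1.
have mn : measurable_fun setT (fun v : R =>
    ((Normc.normc (fourier_trunc g N%:R v - G v)) ^+ 2)%:E).
  apply/measurable_EFinP; rewrite (_ : (fun v => _) = (fun v : R =>
     (cosT (trunc g N) v - complex.Re (G v)) ^+ 2 +
     (- sinT (trunc g N) v - complex.Im (G v)) ^+ 2)).
    apply: measurable_funD; apply: measurable_funX; apply: measurable_funB => //.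
    exact: measurable_funN.
  by apply/funext => v; rewrite fourier_truncE normc_sqr.
apply/andP; split.
  by apply: integral_ge0 => v _; rewrite lee_fin energy_ge0.
apply: (@le_trans _ _ (\int[leb]_(v in S)
   ((Normc.normc (fourier_trunc g N%:R v - G v)) ^+ 2)%:E)%E).
  apply: ae_ge0_le_integral => //.
  - by move=> v _; rewrite lee_fin energy_ge0.
  - apply/measurable_EFinP/measurable_funTS; exact: measurable_energy.
  - by move=> v _; rewrite lee_fin sqr_ge0.
  - exact: measurable_funTS.
  - apply: ae_lebS (ae_ess_support G) => v Gv Sv.
    rewrite lee_fin fourier_truncE normc_sqr Gv/= ?subr0 ?sqrrN//.
    exact: SG.
apply: ge0_subset_integral => //.
by move=> v _; rewrite lee_fin sqr_ge0.
Qed.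

End BandExtension.

(** * The control *)

Section Symbol.
Context {R : realType}.
Local Notation leb := (@lebesgue_measure R).
Variables (Nc : nat) (gammac omegac : 'I_Nc -> R) (I : 'I_Nc -> set R).
Hypothesis compactI : forall al, compact (I al).

Lemma dsymbE al v :
  dsymb gammac omegac al v = Num.sqrt (symb2 (gammac al) (omegac al ^+ 2 + gammac al ^+ 2) v).
Proof. by []. Qed.

Lemma symb2_ge0 (gam kap v : R) : 0 <= symb2 gam kap v.
Proof. by rewrite addr_ge0 ?sqr_ge0. Qed.

Lemma dsymb_ge0 al v : 0 <= dsymb gammac omegac al v.
Proof. by rewrite dsymbE sqrtr_ge0. Qed.

Lemma continuous_symb2 (gam kap : R) : continuous (symb2 gam kap).
Proof.
have c1 : continuous (fun v : R => kap - v ^+ 2).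
  by apply: ctsB; [move=> v; exact: cvg_cst|apply: ctsM => v; exact: cvg_id].
have c2 : continuous (fun v : R => 2 * gam * v) by apply: ctsZ => v; exact: cvg_id.
exact: (ctsD (ctsM c1 c1) (ctsM c2 c2)).
Qed.

(** A continuous function is bounded on a compact band; this makes the real [sup] in [supd] a
    genuine upper bound. *)
Lemma has_ubound_dsymb al : has_ubound [set dsymb gammac omegac al nu | nu in I al].
Proof.
have cd : {within I al, continuous (dsymb gammac omegac al)}.
  apply: continuous_subspaceT => v.
  by apply: continuous_comp; [exact: continuous_symb2|exact: sqrt_continuous].
have /compact_bounded[M [_ hM]] := continuous_compact cd (@compactI al).
exists (M + 1) => x Ix; apply: le_trans (ler_norm x) _.
by apply: hM => //; rewrite ltrDl.
Qed.

Lemma dsymb_le_supd al v : I al v -> dsymb gammac omegac al v <= supd gammac omegac I al.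
Proof. by move=> Iv; apply: (ub_le_sup (has_ubound_dsymb al)); exists v. Qed.

Lemma supd_ge0 al : 0 <= supd gammac omegac I al.
Proof.
have [[v Iv]|I0] := pselect (exists v, I al v).
  exact: le_trans (dsymb_ge0 al v) (dsymb_le_supd Iv).
(* For an empty band, [sup] takes its default value 0. *)
rewrite /supd (_ : [set _ | _ in _] = set0) ?sup0//.
by rewrite -subset0 => x [v Iv _]; apply: I0; exists v.
Qed.

Lemma supd_le_Delta al : supd gammac omegac I al <= Delta gammac omegac I.
Proof. by rewrite /Delta (le_bigmax _ (supd gammac omegac I)). Qed.

Lemma out_of_band al v : 0 <= v ->
  supd gammac omegac I al ^+ 2 <
    symb2 (gammac al) (omegac al ^+ 2 + gammac al ^+ 2) v ->
  ~ I al v.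
Proof.
move=> v0 + Iv; apply/negP; rewrite -leNgt.
rewrite -(sqr_sqrtr (symb2_ge0 _ _ v)) -dsymbE.
by rewrite lerXn2r ?nnegrE ?dsymb_ge0 ?supd_ge0// dsymb_le_supd.
Qed.

End Symbol.

Section Control.
Context {R : realType}.
Local Notation leb := (@lebesgue_measure R).

(** The control that makes [h] solve the damped oscillator equation. *)
Definition damped_control (gam om : R) (h : R -> R) (t : R) : R :=
  derive1n 2 h t + 2 * gam * derive1n 1 h t + (om ^+ 2 + gam ^+ 2) * h t.

Lemma smooth_has_deriv (h : R -> R) k :
  (forall (k : nat) (x : R), derivable (derive1n k h) x 1) ->
  has_deriv (derive1n k h) (derive1n k.+1 h).
Proof.
move=> dh x; rewrite derive1nS derive1E; exact: derivableP.
Qed.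

Lemma smooth_C2 (h : R -> R) k :
  (forall (k : nat) (x : R), derivable (derive1n k h) x 1) ->
  C2 (derive1n k h) (derive1n k.+1 h) (derive1n k.+2 h).
Proof.
move=> dh; split; [exact: smooth_has_deriv|exact: smooth_has_deriv|].
exact: (has_deriv_continuous (smooth_has_deriv k.+2 dh)).
Qed.

Variables (Nc : nat) (gammac omegac : 'I_Nc -> R) (I : 'I_Nc -> set R).
Hypothesis bandI : forall al, compact (I al) /\ I al `<=` [set nu | 0 < nu].

(** [smooth_bound] holds for every admissible extension with the same left side, so the infimum over
    extensions may be taken. *)
Lemma control_bound (T : R) (al : 'I_Nc) (f h : R -> R) : 0 < T ->
  band_class T (I al) f -> smooth_rep T f h ->
  \int[leb]_(t in `[0, T]) damped_control (gammac al) (omegac al) h t ^+ 2 <=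
  supd gammac omegac I al ^+ 2 * band_norm T (I al) f ^+ 2.
Proof.
move=> T0 [_ [gt0 ext0]] [sh fh]; set X := \int[leb]_(t in _) _.
have cI al0 : compact (I al0) by have [] := bandI al0.
set D := supd gammac omegac I al; have D0 : 0 <= D by exact: supd_ge0.
have X0 : 0 <= X by apply: Rintegral_ge0 => t _; exact: sqr_ge0.
have key gt : band_extension T (I al) f gt -> X <= D ^+ 2 * L2norm gt ^+ 2.
  move=> [gt2 gtf [G [FG sG]]]; rewrite L2norm_sqr//.
  have mg := L2T_measurable gt2; have g2 := L2T_sqr gt2.
  apply: (@smooth_bound _ gt mg g2 T (gammac al)
    (omegac al ^+ 2 + gammac al ^+ 2) D T0 _ h _ _
    (damped_control (gammac al) (omegac al) (derive1n 1 h))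
    (damped_control (gammac al) (omegac al) (derive1n 2 h)) (smooth_C2 0 sh)).
  - apply: (energy_out_cvg _ mg g2 FG).
      exact: measurable_out_of_band.
    (* A frequency v >= 0 in the support lies in the band or is the negative of a point of it; the
       latter is impossible because the band is positive. *)
    move=> v [v0 /(out_of_band (@cI) v0) Iv] /sG[//|[w Iw wv]].
    have [_ Ipos] := bandI al; have := Ipos _ Iw; rewrite /= -oppr_lt0 wv.
    by rewrite ltNge v0.
  (* Iterated derivatives compose by computation, so the control built from a derivative of [h] is
     the same derivative of the control. *)
  - have -> : damped_control (gammac al) (omegac al) (derive1n 1 h) =
      (fun t => derive1n 3 h t + 2 * gammac al * derive1n 2 h t +
       (omegac al ^+ 2 + gammac al ^+ 2) * derive1n 1 h t) by [].
    have -> : damped_control (gammac al) (omegac al) (derive1n 2 h) =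
      (fun t => derive1n 4 h t + 2 * gammac al * derive1n 3 h t +
       (omegac al ^+ 2 + gammac al ^+ 2) * derive1n 2 h t) by [].
    exact: (C2D (C2D (smooth_C2 2 sh) (C2Z _ (smooth_C2 1 sh))) (C2Z _ (smooth_C2 0 sh))).
  - by apply: ae_lebS (ae_lebI gtf fh) => t [h1 h2] tT; rewrite h1// h2.
have ne : [set L2norm gt | gt in band_extension T (I al) f] !=set0.
  by exists (L2norm gt0); exists gt0.
have bn0 : 0 <= band_norm T (I al) f.
  by apply: lb_le_inf => // _ [gt _ <-]; exact: L2norm_ge0.
(* To reach the infimum of the norms, square roots are taken and D is divided out; for D = 0 any
   single extension already gives X <= 0. *)
have [D00|D00] := eqVneq D 0.
  by have := key _ ext0; rewrite D00 expr0n/= !mul0r.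
have Dp : 0 < D by rewrite lt_neqAle eq_sym D00.
have h1 : Num.sqrt X / D <= band_norm T (I al) f.
  apply: lb_le_inf => // _ [gt egt <-]; rewrite ler_pdivrMr// mulrC.
  rewrite -(ler_pXn2r (_ : (0 < 2)%N)) ?nnegrE ?sqrtr_ge0 ?mulr_ge0 ?L2norm_ge0//.
  by rewrite sqr_sqrtr// exprMn key.
rewrite -[X]sqr_sqrtr// -exprMn ler_pXn2r ?nnegrE ?sqrtr_ge0 ?mulr_ge0//.
by rewrite mulrC -ler_pdivrMr.
Qed.

End Control.

(** * The cost of the tracking control *)

Lemma L2_patch_oo (R : realType) (T : R) (f : R -> R) : continuous f -> L2 `]0, T[ f.
Proof.
move=> cf; have mI : measurable (`]0, T[%classic : set (measurableTypeR R)) by [].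
have mf : measurable_fun setT f by exact: continuous_measurable_fun.
have L1oo (k : R -> R) : continuous k ->
    lebesgue_measure.-integrable setT (EFin \o (k \_ `]0, T[)).
  move=> ck; apply: L1_patch => //.
  apply: (integrableS _ _ _ (continuous_integrable_itv 0 T ck)) => //.
  exact: subset_itv_oo_cc.
apply: L2_of_sqr.
  exact: ((measurable_restrictT _ _).1 (measurable_funTS mf)).
rewrite (_ : (fun x => _) = (fun x => f x ^+ 2) \_ `]0, T[).
  by apply: L1oo; exact: (ctsM cf cf).
by apply/funext => x; rewrite patch_sqr.
Qed.

Lemma sqint_continuous (R : realType) (p : nat) (T : R) (f : R -> 'cV[R]_p) :
  (forall i, continuous (fun t => f t i 0)) ->
  sqint T f = (\sum_i \int[lebesgue_measure]_(t in `[0, T]) f t i 0 ^+ 2)%:E.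
Proof.
move=> cf; have cf2 i : continuous (fun t => f t i 0 ^+ 2).
  exact: (ctsM (cf i) (cf i)).
have mf2 i : measurable_fun setT (fun t : R => (f t i 0 ^+ 2)%:E).
  by apply/measurable_EFinP; exact: continuous_measurable_fun.
rewrite /sqint /sqnorm -sumEFin.
under eq_integral do rewrite -sumEFin.
rewrite ge0_integral_sum//.
- apply: eq_bigr => i _; rewrite -(integral_itv_bndoo true false).
    rewrite /Rintegral fineK//; apply: integrable_fin_num => //.
    exact: continuous_integrable_itv.
  exact: (measurable_funTS (mf2 i)).
- by move=> i; exact: (measurable_funTS (mf2 i)).
- by move=> i t _; rewrite lee_fin sqr_ge0.
Qed.

Unset Implicit Arguments.
Set Strict Implicit.

Theorem theorem4p3 (R : realType) (n Nc m : nat)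
    (omega : 'I_n -> R) (gammac omegac : 'I_Nc -> R) (C : 'M[R]_(n, Nc))
    (T mu : R) (Robs : 'M[R]_(m, n))
    (a_r a_r1 a_r2 : R -> 'cV[R]_n)
    (Cdag : 'M[R]_(Nc, n)) (eta_r : R -> 'cV[R]_Nc)
    (I : 'I_Nc -> set R) :
  (forall k, 0 < omega k) ->
  (forall al, 0 < gammac al) ->
  (forall al, 0 < omegac al) ->
  0 < T -> 0 < mu ->
  H2 T a_r a_r1 a_r2 ->
  \rank C = n ->
  C *m Cdag = 1%:M ->
  eta_r = (fun t => Cdag *m (a_r2 t + LambdaM omega *m a_r t)) ->
  (forall al, compact (I al) /\ I al `<=` [set nu | 0 < nu]) ->
  (forall al, band_class T (I al) (fun t => eta_r t al 0)) ->
  a_r 0 = 0 -> a_r1 0 = 0 ->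
  (forall al, exists h,
     [/\ smooth_rep T (fun t => eta_r t al 0) h, h 0 = 0 & derive1 h 0 = 0]) ->
  (optimal_value omega gammac omegac C T mu Robs
     (fun t => Robs *m a_r t) (0, 0, 0, 0)%R
   <= (mu / 2 * \sum_(al < Nc) (supd gammac omegac I al) ^+ 2
                * band_norm T (I al) (fun t => eta_r t al 0) ^+ 2)%:E)%E
  /\
  (optimal_value omega gammac omegac C T mu Robs
     (fun t => Robs *m a_r t) (0, 0, 0, 0)%R
   <= (mu / 2 * Delta gammac omegac I ^+ 2
                * prod_band_norm T I eta_r ^+ 2)%:E)%E.
Proof.
move=> omega0 gamma0 omegac0 T0 mu0 Ha rkC CCdag eta_rE HI Hband a0 a10 Hcomp.
have [h hP] := boolp.choice Hcomp.
have sh al : forall k x, derivable (derive1n k (h al)) x 1 by have [[]] := hP al.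
(* The k-th derivative of the smooth representative of [eta_r]; [u] is then read off from the
   controller equation. *)
pose eta k (t : R) : 'cV[R]_Nc := \col_al derive1n k (h al) t.
pose u (t : R) : 'cV[R]_Nc := eta 2 t + 2 *: (GammaM gammac *m eta 1 t) +
  KM gammac omegac *m eta 0 t.
have uE t al : u t al 0 = damped_control (gammac al) (omegac al) (h al) t.
  by rewrite /u /damped_control /GammaM /KM !mul_diag_mx !mxE mulrA.
have cdk al k : continuous (derive1n k (h al)).
  exact: (has_deriv_continuous (smooth_has_deriv k (sh al))).
have cu al : continuous (fun t => u t al 0).
  rewrite (_ : (fun t => _) = damped_control (gammac al) (omegac al) (h al)).
    exact: (ctsD (ctsD (cdk al 2) (ctsZ (cdk al 1))) (ctsZ (cdk al 0))).
  by apply/funext => t; exact: uE.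
have prim k al : primitive T (fun t => eta k t al 0) (fun t => eta k.+1 t al 0).
  move=> t; rewrite in_itv/= => /andP[t0 _].
  have -> : (fun s => eta k.+1 s al 0) = derive1n k.+1 (h al).
    by apply/funext => s; rewrite mxE.
  rewrite (Rintegral_FTC t0 (smooth_has_deriv k (sh al)))//.
  by rewrite !mxE addrC subrK.
have etaae : {ae lebesgue_measure, forall t : R, t \in `]0, T[ -> eta_r t = eta 0 t}.
  have : {ae lebesgue_measure, forall t : R, forall al : 'I_Nc,
      t \in `]0, T[ -> eta_r t al 0 = h al t}.
    (* There are finitely many channels, so the exceptional null sets can be united. *)
    apply: (@filter_forall _ _ _ _ (ae_filter_ringOfSetsType lebesgue_measure)).
    by move=> al; have [[]] := hP al.
  apply: ae_lebS => t ht tT; apply/matrixP => al j.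
  by rewrite (ord1 j) ht// mxE.
(* The reference is itself the trajectory: almost everywhere C eta = C Cdag (a_r'' + Lambda a_r) =
   a_r'' + Lambda a_r, as [Cdag] is a right inverse. *)
have Hcontrol : a_component omega gammac omegac C T (0, 0, 0, 0) u a_r.
  exists a_r1, a_r2, (eta 0), (eta 1), (eta 2); split => //.
  - split; last by move=> al; split; exact: prim.
    move=> al; rewrite (_ : (fun t => _) = derive1n 2 (h al)).
      exact: L2_patch_oo.
    by apply/funext => t; rewrite mxE.
  - rewrite a0 a10; congr (_, _, _, _); apply/matrixP => al j;
      rewrite !mxE; have [_ h0 h1] := hP al; [exact: h0|exact: h1].
  - move: etaae; apply: ae_lebS => t ht tT.
    by rewrite -ht// eta_rE mulmxA CCdag mul1mx.
  - by apply: aeW.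
have L2u : L2vec `]0, T[ u by move=> al; exact: L2_patch_oo.
have cost0 : sqint T (fun t => Robs *m a_r t - Robs *m a_r t) = 0%E.
  rewrite /sqint; apply: integral0_eq => t _; rewrite subrr /sqnorm.
  by rewrite big1// => i _; rewrite mxE expr0n.
have D0 al : 0 <= supd gammac omegac I al.
  by apply: supd_ge0 => al'; have [] := HI al'.
have V_le : (optimal_value omega gammac omegac C T mu Robs
     (fun t => Robs *m a_r t) (0, 0, 0, 0)%R
   <= (mu / 2 * \sum_(al < Nc) (supd gammac omegac I al) ^+ 2
                * band_norm T (I al) (fun t => eta_r t al 0) ^+ 2)%:E)%E.
  (* [u] is a competitor with zero tracking cost, so the infimum is at most its control cost, which
     is estimated channel by channel. *)
  apply: (@le_trans _ _ ((mu / 2)%R%:E * sqint T u)%E).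
    apply: ereal_inf_lbound; exists u, a_r; split => //.
    by rewrite cost0 mule0 add0e.
  rewrite sqint_continuous// -EFinM lee_fin ler_wpM2l ?divr_ge0 ?(ltW mu0)//.
  apply: ler_sum => al _; under eq_Rintegral do rewrite uE.
  by apply: control_bound => //; have [] := hP al.
(* The second bound replaces each supremum by their maximum; the squared product norm is the sum of
   the squared channel norms. *)
split => //; apply: (le_trans V_le); rewrite lee_fin -[leRHS]mulrA.
rewrite ler_wpM2l ?divr_ge0 ?(ltW mu0)// sqr_sqrtr; last first.
  by apply: sumr_ge0 => al _; exact: sqr_ge0.
rewrite mulr_sumr; apply: ler_sum => al _; rewrite ler_wpM2r ?sqr_ge0//.
by rewrite lerXn2r ?nnegrE ?D0 ?(le_trans (D0 al)) ?supd_le_Delta.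
Qed.
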